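(* Let $F_1,F_2\in\mathbb{K}[X_1,X_2,X_3]$ be a sequence of homogeneous forms of degree $2$ without common factors such that $(0:0:1)\in V(F_1,F_2)$ and $T_1F_2(X)-T_2F_1(X)$ does not define a degenerate conic in $\mathbb{P}^2_{\overline{\mathbb{K}(T_1,T_2)}}$. Consider any quadratic transformation of the form $$\Lambda_F:\mathbb{P}^2\dashrightarrow\mathbb{P}^2,\qquad (x_1:x_2:x_3)\mapsto(F_1(x):F_2(x):F_3(x)),$$ with $F_3\in\mathbb{K}[X_1,X_2,X_3]$ homogeneous of degree $2$. A curve $C\subset\mathbb{P}^2$ such that $\deg(C)\geq3$ is parameterizable by $(F_1,F_2)$ if and only if there exists a curve $C_0\subset\mathbb{P}^2$ parameterizable by lines, having $(0:0:1)$ as its only singular point, such that $\overline{\Lambda_F(C)}=C_0$.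
   Context: $\mathbb{K}$ is an algebraically closed field, $X=(X_1,X_2,X_3)$, and $V(F_1,F_2)\subset\mathbb{P}^2$ is the set of common zeros. A conic over the algebraically closed field $\overline{\mathbb{K}(T_1,T_2)}$ is degenerate if its quadratic form is a product of two linear forms over that field. A curve in $\mathbb{P}^2$ is the zero locus of an irreducible homogeneous polynomial. The bar over a subset of $\mathbb{P}^2$ denotes Zariski closure (for a rational map, the closure of the image of the points of the curve where the map is defined). A quadratic transformation is a birational map $\mathbb{P}^2\dashrightarrow\mathbb{P}^2$ given by three homogeneous forms of degree $2$ without common factors. For homogeneous $G_1,G_2\in\mathbb{K}[X]$ of the same degree and without common factors, a curve $C\subset\mathbb{P}^2$ is parameterizable by $(G_1,G_2)$ if the rational map $\psi:C\dashrightarrow\mathbb{P}^1$, $x\mapsto(G_1(x):G_2(x))$, is birational with inverse a map $\phi:\mathbb{P}^1\to C$ given by three homogeneous polynomials in $\mathbb{K}[T_1,T_2]$ of the same degree without common factors. A curve is parameterizable by lines if it is parameterizable by some pair $(G_1,G_2)$ of forms of degree $1$.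
   Formalization: When C_0 is a conic, ''having (0:0:1) as its only singular point'' is replaced by ''(0:0:1) lies on C_0'': irreducible conics are smooth, so the literal equivalence fails for some quartics C whose image is a smooth conic through (0:0:1). *)

(* Defs.v *)
From HB Require Import structures.
From mathcomp Require Import all_boot all_order all_algebra.
From mathcomp Require Import fraction mpoly.

Set Implicit Arguments.
Unset Strict Implicit.
Unset Printing Implicit Defensive.

Import GRing.Theory.
Local Open Scope ring_scope.

(* A point of P^(n-1) is represented by a nonzero row vector x : 'rV[K]_n;
   two such vectors represent the same point when they are proportional.   *)
Definition same_point (K : fieldType) n (x y : 'rV[K]_n) : Prop :=
  exists2 c : K, c != 0 & x = c *: y.

(* (0 : 0 : 1) *)
Definition pt001 (K : fieldType) : 'rV[K]_3 := delta_mx 0 ord_max.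

Definition vanishes_at (K : fieldType) n (f : {mpoly K[n]}) (x : 'rV[K]_n) :
  Prop := f.@[x 0] = 0.

Definition eval_forms (K : fieldType) m n
    (F : m.-tuple {mpoly K[n]}) (x : 'rV[K]_n) : 'rV[K]_m :=
  \row_i (tnth F i).@[x 0].

Definition forms_of_degree (K : fieldType) m n d
    (F : m.-tuple {mpoly K[n]}) : Prop :=
  forall i, tnth F i \is d.-homog.

(* The units of {mpoly K[n]} are the nonzero constants.  In particular the
   zero tuple does have common factors.                                    *)
Definition no_common_factor (K : fieldType) m n
    (F : m.-tuple {mpoly K[n]}) : Prop :=
  forall h, (forall i, exists q, tnth F i = q * h) -> h \is a GRing.unit.

Definition irreducible_mpoly (K : fieldType) n (f : {mpoly K[n]}) : Prop :=
  f \isn't a GRing.unit /\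
  forall g h, f = g * h -> g \is a GRing.unit \/ h \is a GRing.unit.

(* f defines a plane curve of degree d; the curve is the zero locus of f.
   An irreducible f is nonzero, so that d is determined by f.              *)
Definition plane_curve (K : fieldType) d (f : {mpoly K[3]}) : Prop :=
  f \is d.-homog /\ irreducible_mpoly f.

Definition comp_forms (K : fieldType) m n k
    (G : m.-tuple {mpoly K[n]}) (F : n.-tuple {mpoly K[k]}) :
    m.-tuple {mpoly K[k]} :=
  [tuple tnth G i \mPo F | i < m].

(* The rational map x |-> (H_1(x) : ... : H_n(x)) is defined somewhere and is
   the identity of P^(n-1).                                                *)
Definition identity_map (K : fieldType) n (H : n.-tuple {mpoly K[n]}) : Prop :=
  exists2 h : {mpoly K[n]}, h != 0 & forall i, tnth H i = h * 'X_i.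

Definition quadratic_transformation (K : fieldType)
    (F : 3.-tuple {mpoly K[3]}) : Prop :=
  [/\ forms_of_degree 2 F, no_common_factor F &
      exists d, exists G : 3.-tuple {mpoly K[3]},
        [/\ forms_of_degree d G, no_common_factor G,
            identity_map (comp_forms G F) & identity_map (comp_forms F G)]].

(* The curve V(f) is parameterizable by G = (G_1, G_2): the forms phi map P^1
   to V(f) and are inverse to the rational map given by G on V(f).  Two
   rational maps on V(f) are equal when they agree on a nonempty open subset,
   here the set where G does not vanish (nonempty by the identity_map clause:
   it contains phi(t) for all but finitely many t).                        *)
Definition parameterizable (K : fieldType)
    (G : 2.-tuple {mpoly K[3]}) (f : {mpoly K[3]}) : Prop :=
  exists e, exists phi : 3.-tuple {mpoly K[2]},
    [/\ forms_of_degree e phi /\ no_common_factor phi,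
        forall t : 'rV[K]_2, t != 0 -> vanishes_at f (eval_forms phi t),
        identity_map (comp_forms G phi) &
        forall x : 'rV[K]_3, x != 0 -> vanishes_at f x ->
          eval_forms G x != 0 ->
          same_point (eval_forms phi (eval_forms G x)) x].

Definition parameterizable_by_lines (K : fieldType) (f : {mpoly K[3]}) : Prop :=
  exists G : 2.-tuple {mpoly K[3]},
    [/\ forms_of_degree 1 G, no_common_factor G & parameterizable G f].

Definition singular_point (K : fieldType) (f : {mpoly K[3]}) (x : 'rV[K]_3) :
    Prop :=
  vanishes_at f x /\ forall i : 'I_3, vanishes_at (mderiv i f) x.

(* The point p is the only singular point of V(f).  A conic parameterizable by
   the lines through p is smooth: p has multiplicity deg(f) - 1 = 1 on it.
   For conics, and only for them, p is therefore just required to lie on the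
   curve; without this case the criterion fails for C of degree 3 or 4 whose
   image is a smooth conic, e.g. for X_2^2X_3^2 + X_1^2X_3^2 - 2X_1^2X_2^2
   and (X_2X_3 - X_1X_2, X_1X_3 - X_1X_2, X_1X_2) (characteristic not 2).  *)
Definition only_singular_point (K : fieldType) (f : {mpoly K[3]})
    (p : 'rV[K]_3) : Prop :=
  (singular_point f p \/ (f \is 2.-homog /\ vanishes_at f p)) /\
  forall x : 'rV[K]_3, x != 0 -> singular_point f x -> same_point x p.

Definition image_of_curve (K : fieldType) (F : 3.-tuple {mpoly K[3]})
    (f : {mpoly K[3]}) (y : 'rV[K]_3) : Prop :=
  exists x : 'rV[K]_3,
    [/\ x != 0, vanishes_at f x, eval_forms F x != 0 &
        same_point y (eval_forms F x)].

Definition zariski_closure (K : fieldType) n (S : 'rV[K]_n -> Prop)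
    (p : 'rV[K]_n) : Prop :=
  forall d (g : {mpoly K[n]}), g \is d.-homog ->
    (forall y, S y -> vanishes_at g y) -> vanishes_at g p.

(* The embedding iota makes L an algebraic closure of k. *)
Definition algebraic_closure (k : fieldType) (L : closedFieldType)
    (iota : {rmorphism k -> L}) : Prop :=
  forall x : L, algebraicOver iota x.

(* T_1 F_2(X) - T_2 F_1(X), with coefficients in an extension L of K(T_1,T_2). *)
Definition pencil (K L : fieldType)
    (iota : {rmorphism {fraction {mpoly K[2]}} -> L})
    (F1 F2 : {mpoly K[3]}) : {mpoly L[3]} :=
  let emb (p : {mpoly K[2]}) : L := iota (tofrac p) in
  let base (c : K) : L := emb c%:MP in
  emb 'X_ord0 *: map_mpoly base F2 - emb 'X_ord_max *: map_mpoly base F1.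

Definition degenerate_conic (L : fieldType) (q : {mpoly L[3]}) : Prop :=
  exists l1 l2 : {mpoly L[3]},
    [/\ l1 \is 1.-homog, l2 \is 1.-homog & q = l1 * l2].

(* Main.v *)
Require Import Defs.
From mathcomp Require Import all_boot all_order all_algebra.
From mathcomp Require Import fraction mpoly.
From Stdlib Require Import Classical.

Set Implicit Arguments.
Unset Strict Implicit.
Unset Printing Implicit Defensive.

Import GRing.Theory.
Local Open Scope ring_scope.

(* A rational parameterization phi of an irreducible V(f) determines it: the
   kernel of g |-> g(phi) is a prime ideal, and its homogeneous elements are
   the multiples of f. So identities between rational maps on V(f) can be
   checked after substituting phi, and "phi inverts G on V(f)" follows from
   G(phi) = h (T_1, T_2) because f divides phi_i(G) X_j - phi_j(G) X_i.
   A curve parameterizable by the lines through p = (0 : 0 : 1) has an equation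
   A X_3 + B with A, B forms in X_1, X_2, and is parameterized by
   (A T_1 : A T_2 : - B). If phi inverts (F_1, F_2) on C, then F(phi) has this
   shape after cancelling common factors, and deg A > 0 because otherwise f
   would divide a quadratic form. Conversely the inverse of Lambda_F carries the
   parameterization of C_0 to one of C. If C_0 is singular at p, the center of
   the projection must be p, because the curve is smooth wherever the projection
   is defined. *)

(** * Homogeneous polynomials *)

(** That [f] generates the kernel of its parameterization is in essence a fact about primes of
    height one. It is obtained by pseudo-division in X_3 over the forms in X_1, X_2. Over an
    algebraically closed field these forms are products of linear ones, so denominators can be
    removed one linear factor at a time.

    Closures are compared through points, whereas the algebra concerns forms. The bridge is that a
    binary form vanishing at every parameter is zero; parameters at which a map is undefined are
    absorbed by multiplying with a nonzero form that vanishes there.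

    The obstacle in the converse is that the inverse of Lambda_F might be undefined all along C_0,
    or send C_0 into the base points of Lambda_F. The first is excluded because the inverse has no
    common factor, the second because the image of C is dense in C_0.

    When C_0 is a conic through p, the center of its projection need not be p. *)

Section MPolyFacts.

Variables (R : idomainType).

Lemma mpoly_ring_ind n (P : {mpoly R[n]} -> Prop) :
  (forall c, P c%:MP) -> (forall i, P 'X_i) ->
  (forall p q, P p -> P q -> P (p + q)) ->
  (forall p q, P p -> P q -> P (p * q)) -> forall p, P p.
Proof.
move=> PC PX PD PM p; rewrite (mpolyE p).
have P0 : P 0 by rewrite -(mpolyC0 n R).
have P1 : P 1 by rewrite -(mpolyC1 n R).
apply: big_ind => // m _; rewrite -mul_mpolyC; apply: (PM) => //.
rewrite mpolyXE_id; apply: big_ind => // i _.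
by elim: (m i) => [|k IHk]; rewrite ?expr0 // exprS; apply: PM.
Qed.

Lemma comp_mpolyXt n k (F : n.-tuple {mpoly R[k]}) i : 'X_i \mPo F = tnth F i.
Proof. by rewrite comp_mpolyXU -tnth_nth. Qed.

Lemma comp_mpolyM n k (F : n.-tuple {mpoly R[k]}) :
  {morph comp_mpoly F : p q / p * q}.
Proof. exact: rmorphM. Qed.

Lemma dhomogXU n (i : 'I_n) : ('X_i : {mpoly R[n]}) \is 1.-homog.
Proof. by rewrite dhomogX; apply/eqP/mdeg1. Qed.

Lemma dhomog_comp n k d e (p : {mpoly R[n]}) (F : n.-tuple {mpoly R[k]}) :
  p \is d.-homog -> (forall i, tnth F i \is e.-homog) ->
  p \mPo F \is (e * d).-homog.
Proof.
move=> /dhomogP p_d F_e.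
have p_d' m : m \in msupp p -> mdeg m = d by exact: p_d.
rewrite comp_mpolyEX big_seq; apply: rpred_sum => m mp.
apply: rpredZ; rewrite comp_mpolyX -(p_d' m mp) mdegE big_distrr /=.
elim/big_rec2: _ => [|i x y _ IH]; first exact: dhomog1.
by apply: dhomogM => //; apply: dhomogMn.
Qed.

Lemma comp_scaled n k d (h : {mpoly R[k]}) (p : {mpoly R[n]})
    (F G : n.-tuple {mpoly R[k]}) :
  p \is d.-homog -> (forall i, tnth G i = h * tnth F i) ->
  p \mPo G = h ^+ d * (p \mPo F).
Proof.
move=> /dhomogP p_d GE.
have p_d' m : m \in msupp p -> mdeg m = d by exact: p_d.
rewrite !comp_mpolyEX big_distrr /= !big_seq.
apply: eq_bigr => m mp; rewrite -scalerAr; congr (_ *: _).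
rewrite !comp_mpolyX -(p_d' m mp) mdegE -prodrXr -big_split /=.
by apply: eq_bigr => i _; rewrite GE exprMn.
Qed.

Lemma meval_scaled n d (c : R) (p : {mpoly R[n]}) (v w : 'I_n -> R) :
  p \is d.-homog -> (forall i, w i = c * v i) -> p.@[w] = c ^+ d * p.@[v].
Proof.
move=> /dhomogP p_d wE.
have p_d' m : m \in msupp p -> mdeg m = d by exact: p_d.
rewrite !mevalE big_distrr /= !big_seq.
apply: eq_bigr => m mp; rewrite mulrCA; congr (_ * _).
rewrite -(p_d' m mp) mdegE -prodrXr -big_split /=.
by apply: eq_bigr => i _; rewrite wE exprMn.
Qed.

Lemma meval_comp n k (p : {mpoly R[n]}) (F : n.-tuple {mpoly R[k]})
    (v : 'I_k -> R) (w : 'I_n -> R) :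
  (forall i, (tnth F i).@[v] = w i) -> (p \mPo F).@[v] = p.@[w].
Proof. by move=> FE; rewrite comp_mpoly_meval; apply: meval_eq. Qed.

Lemma dhomog_meval0 n d (p : {mpoly R[n]}) (v : 'I_n -> R) :
  p \is d.-homog -> (0 < d)%N -> (forall i, v i = 0) -> p.@[v] = 0.
Proof.
move=> p_d d_gt0 v0; rewrite (@meval_scaled n d 0 p v v) //.
  by rewrite expr0n gtn_eqF // mul0r.
by move=> i; rewrite v0 mul0r.
Qed.

Lemma dhomog0_const n (p : {mpoly R[n]}) : p \is 0.-homog -> exists c, p = c%:MP.
Proof.
move=> p0; exists p@_0; apply/mpolyP => m; rewrite mcoeffC.
have [->|m0] := eqVneq m 0%MM; first by rewrite mulr1.
by rewrite mulr0 (dhomog_nemf_coeff p0) // mdeg_eq0.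
Qed.

(** At each step one of the two factors vanishes at 0 and gives up a factor X. For D = 0 degrees are
    additive because [S] is a domain, so both factors are constants. *)
Lemma poly_mul_eq_monomial (S : idomainType) D (u v : {poly S}) c :
  c != 0 -> u * v = c *: 'X^D -> exists i a, u = a *: 'X^i.
Proof.
move=> c0; have X0 : 'X != 0 :> {poly S} by rewrite -size_poly_eq0 size_polyX.
elim: D u v => [|D IHD] u v uvE.
  have nz : u * v != 0 by rewrite uvE expr0 alg_polyC polyC_eq0.
  have [u0 v0] : u != 0 /\ v != 0.
    by move: nz; rewrite mulf_eq0 negb_or => /andP.
  have : (size u <= 1)%N.
    move: (size_mul u0 v0); rewrite uvE expr0 alg_polyC size_polyC c0.
    rewrite (polySpred u0) (polySpred v0) addSn addnS /=.
    by case: (size u).-1.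
  by move=> /size1_polyC ->; exists 0, u`_0; rewrite expr0 alg_polyC.
have := congr1 (fun w : {poly S} => w`_0) uvE.
rewrite coef0M coefZ coefXn mulr0 => /eqP; rewrite mulf_eq0 => /orP[] /eqP w0.
  have /factor_theorem[u'] : root u 0 by rewrite /root horner_coef0 w0.
  rewrite subr0 => uE; move: uvE; rewrite uE mulrAC exprSr scalerAl.
  move=> /(mulIf X0) /IHD[i [a ->]].
  by exists i.+1, a; rewrite exprSr scalerAl.
have /factor_theorem[v'] : root v 0 by rewrite /root horner_coef0 w0.
rewrite subr0 => vE; move: uvE; rewrite vE mulrA exprSr scalerAl.
by move=> /(mulIf X0) /IHD.
Qed.

(* Under X_i |-> T X_i, a polynomial p becomes the sum of its homogeneous
   components p_d T^d; so p is homogeneous iff it becomes a monomial in T. *)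
Lemma dhomog_factor n d (p q : {mpoly R[n]}) :
  p * q \is d.-homog -> p * q != 0 ->
  exists i j, [/\ p \is i.-homog, q \is j.-homog & d = (i + j)%N].
Proof.
pose tau := mmap (polyC \o @mpolyC n R) (fun i => 'X * ('X_i)%:P).
have tauM : {morph tau : u v / u * v} by apply: rmorphM.
have tauE u : tau u = \sum_(m <- msupp u) (u@_m *: 'X_[m]) *: 'X^(mdeg m).
  apply: eq_bigr => m _; rewrite -mul_mpolyC /= -!mul_polyC polyCM -!mulrA.
  congr (_ * _); rewrite /mmap1 mpolyXE_id rmorph_prod /= mdegE -prodrXr.
  rewrite -big_split /=; apply: eq_bigr => i _.
  by rewrite exprMn mulrC rmorphXn.
have tau_homog u k : u \is k.-homog -> tau u = u *: 'X^k.
  move=> /dhomogP uk; rewrite tauE -mul_polyC {3}(mpolyE u) rmorph_sum /=.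
  rewrite big_distrl !big_seq; apply: eq_bigr => m mu.
  by rewrite (uk m mu : mdeg m = k) -mul_polyC.
(* The coefficient of T^i in [tau u] is the component of degree i of [u], and T = 1 gives back [u];
   for a monomial in T the two coincide. *)
have homog_tau i a u : tau u = a *: 'X^i -> u \is i.-homog.
  move=> uE; suff -> : u = pihomog mdeg i u by apply: pihomogP.
  have -> : pihomog mdeg i u = (tau u)`_i.
    rewrite pihomogE tauE coef_sum big_mkcond /=.
    apply: eq_bigr => m _; rewrite coefZ coefXn eq_sym.
    by case: eqP => _; rewrite ?mulr1 ?mulr0.
  have u1 : u = (tau u).[1].
    rewrite tauE horner_sum {1}(mpolyE u); apply: eq_bigr => m _.
    by rewrite hornerZ hornerXn expr1n mulr1.
  by rewrite uE coefZ coefXn eqxx mulr1 u1 uE hornerZ hornerXn expr1n mulr1.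
move=> pq_d pq0; have pqE := tau_homog _ _ pq_d.
have [i [a pE]] := poly_mul_eq_monomial pq0 (etrans (esym (tauM p q)) pqE).
have qp0 : q * p != 0 by rewrite mulrC.
rewrite mulrC in pqE; have [j [b qE]] :=
  poly_mul_eq_monomial qp0 (etrans (esym (tauM q p)) pqE).
exists i, j; split; [exact: homog_tau pE | exact: homog_tau qE |].
apply: dhomog_uniq pq0 pq_d _; apply: dhomogM; first exact: homog_tau pE.
exact: homog_tau qE.
Qed.

End MPolyFacts.

Lemma comp_formsE (K : fieldType) m n k (G : m.-tuple {mpoly K[n]})
  (F : n.-tuple {mpoly K[k]}) i : tnth (comp_forms G F) i = tnth G i \mPo F.
Proof. by rewrite tnth_mktuple. Qed.

Lemma comp_mpolyA (K : fieldType) m n k (p : {mpoly K[m]})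
    (F : m.-tuple {mpoly K[n]}) (G : n.-tuple {mpoly K[k]}) :
  (p \mPo F) \mPo G = p \mPo (comp_forms F G).
Proof.
elim/mpoly_ring_ind: p => [c|i|p q IHp IHq|p q IHp IHq].
- by rewrite !comp_mpolyC.
- by rewrite !comp_mpolyXt comp_formsE.
- by rewrite !rmorphD /= IHp IHq.
- by rewrite !rmorphM /= IHp IHq.
Qed.

Lemma mpoly_unitP (K : fieldType) n (p : {mpoly K[n]}) :
  reflect (exists2 c, c != 0 & p = c%:MP) (p \is a GRing.unit).
Proof.
apply: (iffP andP) => [[/eqP pE]|[c c0 ->]].
  by rewrite unitfE => p0; exists p@_0.
by rewrite mcoeffC eqxx mulr1 unitfE.
Qed.

Lemma comp_unit (K : fieldType) n k (p : {mpoly K[n]})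
    (F : n.-tuple {mpoly K[k]}) :
  p \is a GRing.unit -> p \mPo F != 0.
Proof. by move=> /mpoly_unitP[c c0 ->]; rewrite comp_mpolyC mpolyC_eq0. Qed.

(** * Binary forms *)

(** Substitution is a ring morphism, so it respects congruence modulo [w]. This takes the place of
    division in the factor theorem for binary forms. *)
Lemma comp_dvd (R : idomainType) n k (p : {mpoly R[n]}) (w : {mpoly R[k]})
    (F G : n.-tuple {mpoly R[k]}) :
  (forall i, exists q, tnth F i - tnth G i = w * q) ->
  exists q, (p \mPo F) - (p \mPo G) = w * q.
Proof.
move=> FG; elim/mpoly_ring_ind: p => [c|i|p q [u pE] [v qE]|p q [u pE] [v qE]].
- by exists 0; rewrite !comp_mpolyC subrr mulr0.
- by rewrite !comp_mpolyXt.
- by exists (u + v); rewrite !rmorphD /= opprD addrACA pE qE mulrDr.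
- exists (u * (q \mPo F) + (p \mPo G) * v); rewrite !rmorphM /=.
  by rewrite mulrDr mulrA -pE mulrCA -qE mulrBl mulrBr addrA subrK.
Qed.

Lemma ord2P (i : 'I_2) : i = ord0 \/ i = ord_max.
Proof. by case: i => [[|[|//]] ?]; [left|right]; apply: val_inj. Qed.

Lemma row2_neq0 (K : fieldType) (a : 'rV[K]_2) :
  (a != 0) = (a 0 ord0 != 0) || (a 0 ord_max != 0).
Proof.
apply/idP/orP => [a0|]; last first.
  by case; apply: contraNneq => ->; rewrite mxE.
have [a1|] := eqVneq (a 0 ord0) 0; [right|by left].
apply: contraNneq a0 => a2; apply/eqP/rowP => i; rewrite mxE.
by case: (ord2P i) => ->.
Qed.

Definition pt2 (K : fieldType) (x y : K) : 'rV[K]_2 :=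
  \row_i (if i == ord0 then x else y).

Section BinaryForms.

Variable K : closedFieldType.
Implicit Types (c : {mpoly K[2]}) (a : 'rV[K]_2).

(** The determinant of (X_1, X_2) and [a]: for nonzero [a], its only zero in P^1 is the point
    [a]. *)
Definition lform a : {mpoly K[2]} :=
  a 0 ord_max *: 'X_ord0 - a 0 ord0 *: 'X_ord_max.

Lemma lform_homog a : lform a \is 1.-homog.
Proof. by apply: rpredB; apply: rpredZ; apply: dhomogXU. Qed.

Lemma lformE a (v : 'I_2 -> K) :
  (lform a).@[v] = a 0 ord_max * v ord0 - a 0 ord0 * v ord_max.
Proof. by rewrite mevalB !mevalZ !mevalXU. Qed.

Lemma lform_root a : (lform a).@[a 0] = 0.
Proof. by rewrite lformE mulrC subrr. Qed.

Lemma lform_neq0 a : a != 0 -> lform a != 0.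
Proof.
rewrite row2_neq0; apply: contraTneq => l0.
have := congr1 (fun p => p.@[pt2 1 0 0]) l0.
have := congr1 (fun p => p.@[pt2 0 1 0]) l0.
rewrite !lformE !mxE !meval0 !mulr0 !mulr1 sub0r subr0 => /eqP.
by rewrite oppr_eq0 => /eqP -> ->; rewrite eqxx.
Qed.

Lemma lform_nunit a : lform a \isn't a GRing.unit.
Proof.
apply/negP => /mpoly_unitP[x x0 lE]; have := lform_root a.
by rewrite lE mevalC => xE; rewrite xE eqxx in x0.
Qed.

(** If a_i is nonzero, then X_j is congruent to (a_j / a_i) X_i modulo [lform a], so c is congruent
    to c(a) (X_i / a_i)^k, which is 0. *)
Lemma binary_form_root k c a : c \is k.-homog -> a != 0 -> c.@[a 0] = 0 ->
  exists q, c = lform a * q.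
Proof.
move=> c_k a0 ca0.
have [i ai0] : exists i, a 0 i != 0.
  by move: a0; rewrite row2_neq0 => /orP[]; [exists ord0|exists ord_max].
pose F : 2.-tuple {mpoly K[2]} := [tuple 'X_j | j < 2].
pose G : 2.-tuple {mpoly K[2]} := [tuple (a 0 j / a 0 i) *: 'X_i | j < 2].
have FG j : exists q, tnth F j - tnth G j = lform a * q.
  (* The difference X_j - (a_j / a_i) X_i is 0 for j = i; otherwise it is [lform a] divided by a_i,
     up to a sign that depends on which index is j. *)
  exists (((j == ord0)%:R - (i == ord0)%:R) / a 0 i)%:MP.
  rewrite !tnth_mktuple [lform a * _]mulrC mul_mpolyC.
  case: (ord2P i) ai0 => -> ai0; case: (ord2P j) => ->;
    rewrite ?subrr ?mul0r ?scale0r ?divff ?scale1r ?subrr //= /lform.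
    rewrite sub0r mulN1r scaleNr scalerBr !scalerA mulVf // scale1r opprB.
    by rewrite [_^-1 * _]mulrC.
  rewrite subr0 mul1r scalerBr !scalerA mulVf // scale1r.
  by rewrite [_^-1 * _]mulrC.
have [q] := comp_dvd c FG; rewrite comp_mpoly_id.
suff -> : c \mPo G = 0 by rewrite subr0; exists q.
pose G1 : 2.-tuple {mpoly K[2]} := [tuple (a 0 j / a 0 i)%:MP | j < 2].
rewrite (@comp_scaled _ _ _ k 'X_i _ G1) //; last first.
  by move=> j; rewrite !tnth_mktuple -mul_mpolyC [RHS]mulrC.
have -> : c \mPo G1 = (c.@[fun j => (a 0 i)^-1 * a 0 j])%:MP.
  elim/(@mpoly_ring_ind K 2): {c_k ca0} c => [x|j|p r IHp IHr|p r IHp IHr].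
  - by rewrite comp_mpolyC mevalC.
  - by rewrite comp_mpolyXt mevalXU tnth_mktuple mulrC.
  - by rewrite rmorphD mevalD mpolyCD /= IHp IHr.
  - by rewrite rmorphM mevalM mpolyCM /= IHp IHr.
by rewrite (@meval_scaled _ _ _ (a 0 i)^-1 _ (a 0) _ c_k) // ca0 mulr0 mulr0.
Qed.

Definition line_poly n (p : {mpoly K[n]}) (u v : 'I_n -> K) : {poly K} :=
  mmap polyC (fun i => (u i)%:P + v i *: 'X) p.

Lemma line_polyE n (p : {mpoly K[n]}) u v s :
  (line_poly p u v).[s] = p.@[fun i => u i + v i * s].
Proof.
elim/mpoly_ring_ind: p => [c|i|p q IHp IHq|p q IHp IHq].
- by rewrite /line_poly mmapC mevalC hornerC.
- by rewrite /line_poly mmapX mmap1U mevalXU hornerD hornerC hornerZ hornerX.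
- by rewrite /line_poly rmorphD mevalD hornerD IHp IHq.
- by rewrite /line_poly rmorphM mevalM hornerM IHp IHq.
Qed.

Lemma poly_vanish (p : {poly K}) : (forall x, p.[x] = 0) -> p = 0.
Proof.
by move=> p0; apply/eqP/contraT => /closed_nonrootP[x]; rewrite /root p0 eqxx.
Qed.

(** If c(s, 1) has no root, it is a constant x; homogeneity then gives c(1, s) = x s^k, so (1 : 0)
    is a root because k > 0. *)
Lemma binary_form_has_root k c : c \is k.-homog -> (0 < k)%N ->
  exists2 a : 'rV[K]_2, a != 0 & c.@[a 0] = 0.
Proof.
move=> c_k k_gt0.
have [c10|c10] := eqVneq (c.@[pt2 1 0 0]) 0.
  by exists (pt2 1 0) => //; rewrite row2_neq0 !mxE oner_neq0.
have [/closed_rootP[r]|] := boolP (size (line_poly c (pt2 0 1 0) (pt2 1 0 0)) != 1%N).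
  move=> /rootP; rewrite line_polyE => cr.
  exists (pt2 r 1); first by rewrite row2_neq0 !mxE oner_neq0 orbT.
  rewrite -[RHS]cr; apply: meval_eq => i; rewrite !mxE.
  by case: eqP; rewrite ?add0r ?mul1r ?mul0r ?addr0.
rewrite negbK => /size_poly1P[x x0 cE].
(* The factor X removes s = 0, where the identity c(1, s) = s^k c(1/s, 1) is meaningless. *)
suff w0 : (line_poly c (pt2 1 0 0) (pt2 0 1 0) - x *: 'X^k) * 'X = 0.
  case/negP: c10; move/eqP: w0; rewrite mulf_eq0 polyX_eq0 orbF subr_eq0.
  move=> /eqP/(congr1 (fun p => p.[0])); rewrite line_polyE hornerZ hornerXn.
  rewrite expr0n gtn_eqF // mulr0 => c1; apply/eqP.
  rewrite -[RHS]c1; apply: meval_eq => i; by rewrite mulr0 addr0.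
apply: poly_vanish => s; rewrite hornerM hornerX.
have [->|s0] := eqVneq s 0; first by rewrite mulr0.
rewrite hornerD hornerN hornerZ hornerXn line_polyE.
rewrite (@meval_scaled _ _ k s _ (fun i => pt2 0 1 0 i + pt2 1 0 0 i * s^-1)) //.
  rewrite -line_polyE cE hornerC [x * _]mulrC. by rewrite subrr mul0r.
move=> i; rewrite !mxE; case: eqP; rewrite ?mul0r ?mul1r ?add0r ?addr0 ?mulr1 //.
by rewrite divff.
Qed.

Lemma binary_form_split k c : c \is k.+1.-homog -> exists a c',
  [/\ a != 0, c' \is k.-homog & c = lform a * c'].
Proof.
move=> c_k; have [->|c0] := eqVneq c 0.
  exists (pt2 1 0), 0; split; [|exact: dhomog0|by rewrite mulr0].
  by rewrite row2_neq0 !mxE oner_neq0.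
have [//|a a0 ca] := binary_form_has_root c_k.
have [q cE] := binary_form_root c_k a0 ca; exists a, q; split=> //.
have := @dhomog_factor _ _ k.+1 (lform a) q; rewrite -cE.
move=> /(_ c_k c0)[i [j [l_i q_j]]].
by rewrite (dhomog_uniq (lform_neq0 a0) l_i (lform_homog a)) add1n => -[->].
Qed.

(** A nonzero form splits into linear forms. Their restrictions to the points (1, s) multiply to a
    nonzero polynomial [u] in s, and some s is not a root of it. *)
Lemma binary_form_vanish k c : c \is k.-homog ->
  (forall a, a != 0 -> c.@[a 0] = 0) -> c = 0.
Proof.
move=> c_k c_van; apply/eqP/contraT => c0.
suff [u u0 uP] : exists2 u : {poly K}, u != 0 &
    forall s, u.[s] != 0 -> c.@[pt2 1 s 0] != 0.
  have /closed_nonrootP[s /uP] := u0.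
  by rewrite c_van ?eqxx // row2_neq0 !mxE oner_neq0.
elim: k c c_k c0 {c_van} => [|k IHk] c c_k c0.
  have [x cE] := dhomog0_const c_k; exists 1; first exact: oner_neq0.
  by move=> s _; rewrite cE mevalC -(mpolyC_eq0 2) -cE.
have [a [c' [a0 c'_k cE]]] := binary_form_split c_k.
have c'0 : c' != 0 by apply: contraNneq c0 => c'0; rewrite cE c'0 mulr0.
have [u u0 uP] := IHk c' c'_k c'0.
exists (u * (line_poly (lform a) (pt2 1 0 0) (pt2 0 1 0))).
  rewrite mulf_neq0 //; move: (a0); rewrite row2_neq0; apply: contraTneq => l0.
  have := congr1 (fun p => p.[0]) l0; have := congr1 (fun p => p.[1]) l0.
  rewrite !line_polyE !lformE !mxE /= !horner0.
  rewrite !(mul0r, mul1r, mulr0, addr0, add0r, mulr1, subr0) => + a20.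
  by rewrite a20 sub0r => /eqP; rewrite oppr_eq0 => /eqP ->; rewrite eqxx.
move=> s; rewrite hornerM line_polyE mulf_eq0 negb_or => /andP[/uP c'P ls].
rewrite cE mevalM mulf_neq0 //; apply: contraNneq ls => ls.
apply/eqP; rewrite -[RHS]ls; apply: meval_eq => i; rewrite !mxE.
by case: eqP; rewrite ?mul0r ?mul1r ?add0r ?addr0.
Qed.

(** A common root [a] would make [lform a] a common factor. *)
Lemma no_common_root m k (F : m.-tuple {mpoly K[2]}) a :
  forms_of_degree k F -> no_common_factor F -> a != 0 -> eval_forms F a != 0.
Proof.
move=> F_k F_cop a0; apply/negP => /eqP Fa.
have /negP[] := lform_nunit a; apply: F_cop => i.
have := congr1 (fun x : 'rV_m => x 0 i) Fa; rewrite !mxE => Fia.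
by have [q ->] := binary_form_root (F_k i) a0 Fia; exists q; rewrite mulrC.
Qed.

(** Eliminating [m] and [N] gives X_2 H_1 = X_1 H_2. Hence H_1 vanishes at (0, 1) and X_1 divides
    it; the quotient works for H_2 too. Divisibility of [N] by [m] never has to be established. *)
Lemma identity_map_cancel k (H : 2.-tuple {mpoly K[2]}) (m N : {mpoly K[2]}) :
  forms_of_degree k H -> m != 0 -> N != 0 ->
  (forall i, m * tnth H i = N * 'X_i) -> identity_map H.
Proof.
move=> H_k m0 N0 HE.
have H01 : 'X_ord_max * tnth H ord0 = 'X_ord0 * tnth H ord_max.
  by apply: (mulfI m0); rewrite mulrCA HE [RHS]mulrCA HE mulrCA [in RHS]mulrCA
    [in RHS](mulrC 'X_ord0).
have a0 : pt2 0 1 != 0 :> 'rV[K]_2 by rewrite row2_neq0 !mxE oner_neq0 orbT.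
have [|h h0] := binary_form_root (H_k ord0) a0.
  have := congr1 (fun p => p.@[pt2 0 1 0]) H01.
  by rewrite !mevalM !mevalXU !mxE /= mul1r mul0r.
rewrite /lform !mxE /= scale1r scale0r subr0 in h0.
have X0 (i : 'I_2) : 'X_i != 0 :> {mpoly K[2]}.
  by rewrite -msize_poly_eq0 msizeX.
exists h; last first.
  move=> i; case: (ord2P i) => ->; first by rewrite h0 mulrC.
  by apply: (mulfI (X0 ord0)); rewrite -H01 h0 mulrCA (mulrC h).
apply: contraNneq N0 => hE; rewrite hE mulr0 in h0.
by have /eqP := HE ord0; rewrite h0 mulr0 eq_sym mulf_eq0 (negPf (X0 _)) orbF.
Qed.

End BinaryForms.

(** A nonunit common factor divides the nonzero entry at [i0], so it is homogeneous of positive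
    degree; the quotients have smaller degree and induction applies. *)
Lemma strip_common_factor (K : fieldType) n m k (F : m.-tuple {mpoly K[n]}) i0 :
  forms_of_degree k F -> tnth F i0 != 0 -> exists e g (P : m.-tuple {mpoly K[n]}),
  [/\ forms_of_degree e P, no_common_factor P, g != 0 &
      forall i, tnth F i = g * tnth P i].
Proof.
elim/ltn_ind: k F => k IHk F F_k F0.
have [F_cop|] := classic (no_common_factor F).
  by exists k, 1, F; split; rewrite ?oner_neq0 // => i; rewrite mul1r.
move=> F_ncop; have [h hP] := not_all_ex_not _ _ F_ncop.
have [hF /negP h_nu] := imply_to_and _ _ hP.
have [q qE] : exists q : 'I_m -> {mpoly K[n]}, forall i, tnth F i = q i * h.
  have [q qE] := fin_all_exists hF; by exists q.
have h0 : h != 0 by apply: contraNneq F0 => h0; rewrite qE h0 mulr0.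
have [i [j [_ h_j kE]]] : exists i j, [/\ q i0 \is i.-homog, h \is j.-homog & k = (i + j)%N].
  by apply: dhomog_factor; rewrite -qE.
have j_gt0 : (0 < j)%N.
  rewrite lt0n; apply: contraNneq h_nu => j0; move: h_j h0; rewrite j0.
  move=> /dhomog0_const[c ->]; rewrite mpolyC_eq0 => c0.
  by apply/mpoly_unitP; exists c.
have i_ltk : (i < k)%N by rewrite kE -[X in (X < _)%N]addn0 ltn_add2l.
pose Q := [tuple q l | l < m].
have Q_i : forms_of_degree i Q.
  move=> l; rewrite tnth_mktuple.
  have [->|ql0] := eqVneq (q l) 0; first exact: dhomog0.
  have := @dhomog_factor _ _ k (q l) h; rewrite -qE.
  have Fl0 : tnth F l != 0 by rewrite qE mulf_neq0.
  move=> /(_ (F_k l) Fl0)[x [y [ql_x h_y]]].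
  by rewrite (dhomog_uniq h0 h_y h_j) kE => /eqP; rewrite eqn_add2r => /eqP ->.
have Q0 : tnth Q i0 != 0.
  by rewrite tnth_mktuple; apply: contraNneq F0 => q0; rewrite qE q0 mul0r.
have [e [g [P [P_e P_cop g0 PE]]]] := IHk i i_ltk Q Q_i Q0.
exists e, (g * h), P; split; rewrite ?mulf_neq0 // => l.
by have := PE l; rewrite tnth_mktuple qE => ->; rewrite mulrAC.
Qed.

(** * Ternary forms as polynomials in the last variable *)

Definition mid3 : 'I_3 := Ordinal (isT : (1 < 3)%N).

Lemma ord3P (i : 'I_3) : [\/ i = ord0, i = mid3 | i = ord_max].
Proof.
by case: i => [[|[|[|//]]] ?]; [apply: Or31|apply: Or32|apply: Or33];
  apply: val_inj.
Qed.

Section LastVariable.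

Variable R : idomainType.
Implicit Types (p : {mpoly R[3]}) (c : {mpoly R[2]}).

Fact uni_key : unit. Proof. by []. Qed.

(* Sealed: unification would otherwise unfold [muni]. *)
Definition uni : {mpoly R[3]} -> {poly {mpoly R[2]}} :=
  locked_with uni_key (@muni 2 R).

Lemma uni_muni : uni = @muni 2 R. Proof. exact: locked_withE. Qed.

Lemma uni0 : uni 0 = 0. Proof. by rewrite uni_muni muni0. Qed.

Lemma uniC (c : R) : uni c%:MP = (c%:MP)%:P. Proof. by rewrite uni_muni muniC. Qed.

Lemma uniD : {morph uni : p q / p + q}. Proof. rewrite uni_muni; exact: muniD. Qed.

Lemma uniB : {morph uni : p q / p - q}. Proof. rewrite uni_muni; exact: muniB. Qed.

Lemma uniM : {morph uni : p q / p * q}. Proof. rewrite uni_muni; exact: muniM. Qed.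

Lemma uniXn n : {morph uni : p / p ^+ n}.
Proof. rewrite uni_muni; exact: rmorphXn. Qed.

Lemma uniE p : uni p = \sum_(m <- msupp p)
  p@_m *: 'X_[[multinom m (widen_ord (leqnSn 2) i) | i < 2]] *: 'X^(m ord_max).
Proof. by rewrite uni_muni muniE. Qed.

Lemma uni_mpolyX (m : 'X_{1..3}) : uni 'X_[R, m] =
  'X_[[multinom m (widen_ord (leqnSn 2) i) | i < 2]] *: 'X^(m ord_max).
Proof. by rewrite uniE msuppX big_seq1 mcoeffX eqxx scale1r. Qed.

Lemma uniX0 : uni ('X_ord0 : {mpoly R[3]}) = ('X_ord0)%:P.
Proof.
rewrite uni_mpolyX mnm1E expr0 alg_polyC; congr (_%:P); congr 'X_[_].
by apply/mnmP => i; rewrite mnmE !mnm1E; case: (ord2P i) => ->.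
Qed.

Lemma uniX1 : uni ('X_mid3 : {mpoly R[3]}) = ('X_ord_max)%:P.
Proof.
rewrite uni_mpolyX mnm1E expr0 alg_polyC; congr (_%:P); congr 'X_[_].
by apply/mnmP => i; rewrite mnmE !mnm1E; case: (ord2P i) => ->.
Qed.

Lemma uniX2 : uni ('X_ord_max : {mpoly R[3]}) = 'X.
Proof.
rewrite uni_mpolyX mnm1E expr1.
rewrite [X in 'X_[X]](_ : _ = 0%MM) ?mpolyX0 ?scale1r //.
by apply/mnmP => i; rewrite mnmE !mnm1E mnm0E; case: (ord2P i) => ->.
Qed.

Definition subst3 k (P : 3.-tuple {mpoly R[k]}) :
    {poly {mpoly R[2]}} -> {mpoly R[k]} :=
  locked_with uni_key (fun u =>
    (map_poly (comp_mpoly [tuple tnth P ord0; tnth P mid3]) u).[tnth P ord_max]).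

Lemma subst3E k (P : 3.-tuple {mpoly R[k]}) u : subst3 P u =
  (map_poly (comp_mpoly [tuple tnth P ord0; tnth P mid3]) u).[tnth P ord_max].
Proof. by rewrite /subst3 locked_withE. Qed.

Lemma subst3D k (P : 3.-tuple {mpoly R[k]}) : {morph subst3 P : u v / u + v}.
Proof. by move=> u v; rewrite !subst3E rmorphD hornerD. Qed.

Lemma subst3M k (P : 3.-tuple {mpoly R[k]}) : {morph subst3 P : u v / u * v}.
Proof. by move=> u v; rewrite !subst3E rmorphM hornerM. Qed.

Lemma subst3C k (P : 3.-tuple {mpoly R[k]}) c :
  subst3 P c%:P = c \mPo [tuple tnth P ord0; tnth P mid3].
Proof. by rewrite subst3E map_polyC hornerC. Qed.

Lemma subst3X k (P : 3.-tuple {mpoly R[k]}) : subst3 P 'X = tnth P ord_max.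
Proof. by rewrite subst3E map_polyX hornerX. Qed.

Lemma subst3_uni k (P : 3.-tuple {mpoly R[k]}) p : subst3 P (uni p) = p \mPo P.
Proof.
elim/mpoly_ring_ind: p => [c|i|p q IHp IHq|p q IHp IHq].
- by rewrite uniC subst3C !comp_mpolyC.
- case: (ord3P i) => ->; rewrite ?uniX0 ?uniX1 ?uniX2 ?subst3C ?subst3X;
  by rewrite !comp_mpolyXt.
- by rewrite uniD subst3D comp_mpolyD; congr (_ + _).
- by rewrite uniM subst3M comp_mpolyM; congr (_ * _).
Qed.

Definition emb3 (u : {poly {mpoly R[2]}}) : {mpoly R[3]} :=
  subst3 [tuple 'X_i | i < 3] u.

Lemma uniK : cancel uni emb3.
Proof. by move=> p; rewrite /emb3 subst3_uni comp_mpoly_id. Qed.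

Lemma emb3D : {morph emb3 : u v / u + v}.
Proof. exact: subst3D. Qed.

Lemma emb3M : {morph emb3 : u v / u * v}.
Proof. exact: subst3M. Qed.

Lemma emb3X : emb3 'X = 'X_ord_max.
Proof. by rewrite /emb3 subst3X tnth_mktuple. Qed.

Lemma uni_emb3C c : uni (emb3 c%:P) = c%:P.
Proof.
rewrite /emb3 subst3C !tnth_mktuple.
elim/(@mpoly_ring_ind R 2): c => [x|i|p q IHp IHq|p q IHp IHq].
- by rewrite comp_mpolyC uniC.
- by rewrite comp_mpolyXt; case: (ord2P i) => ->; rewrite ?uniX0 ?uniX1.
- by rewrite comp_mpolyD uniD polyCD; congr (_ + _).
- by rewrite comp_mpolyM uniM polyCM; congr (_ * _).
Qed.

Lemma emb3K : cancel emb3 uni.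
Proof.
elim/poly_ind => [|u c IHu]; first by rewrite -[0]/(0%:P) uni_emb3C.
by rewrite emb3D emb3M uniD uniM IHu uni_emb3C emb3X uniX2.
Qed.

Lemma uni_inj : injective uni.
Proof. exact: can_inj uniK. Qed.

Lemma emb3_homog k c : c \is k.-homog -> emb3 c%:P \is k.-homog.
Proof.
move=> c_k; rewrite /emb3 subst3C -[k]mul1n; apply: dhomog_comp c_k _.
by move=> i; case: (ord2P i) => ->; rewrite !tnth_mktuple; apply: dhomogXU.
Qed.

Lemma emb3_comp k (P : 3.-tuple {mpoly R[k]}) u : emb3 u \mPo P = subst3 P u.
Proof. by rewrite -subst3_uni emb3K. Qed.

Lemma uni_homog D p i j : p \is D.-homog -> (i + j)%N = D ->
  (uni p)`_i \is j.-homog.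
Proof.
move=> /dhomogP p_D ijD; rewrite uniE coef_sum big_seq; apply: rpred_sum => m mp.
rewrite -mul_mpolyC !coefZ coefXn.
case: eqP => im; last by rewrite !mulr0; apply: dhomog0.
rewrite mulr1 mul_mpolyC; apply: rpredZ; rewrite dhomogX; apply/eqP.
have := p_D m mp; rewrite -ijD /= mdegE big_ord_recr /= -im addnC.
move=> /eqP; rewrite eqn_add2l => /eqP <-; rewrite mdegE.
by apply: eq_bigr => l _; rewrite mnmE.
Qed.

Lemma uni_homog_gt D p i : p \is D.-homog -> (D < i)%N -> (uni p)`_i = 0.
Proof.
move=> /dhomogP p_D Di; rewrite uniE coef_sum big_seq big1 // => m mp.
rewrite -mul_mpolyC !coefZ coefXn.
case: eqP => im; last by rewrite !mulr0.
have := p_D m mp; rewrite /= mdegE big_ord_recr /= -im => mE.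
by move: Di; rewrite -mE ltnNge leq_addl.
Qed.

End LastVariable.

Lemma comp_const (R : idomainType) n k (p : {mpoly R[n]})
    (F : n.-tuple {mpoly R[k]}) (v : 'I_n -> R) :
  (forall i, tnth F i = (v i)%:MP) -> p \mPo F = (p.@[v])%:MP.
Proof.
move=> FE; elim/mpoly_ring_ind: p => [x|j|p r IHp IHr|p r IHp IHr].
- by rewrite comp_mpolyC mevalC.
- by rewrite comp_mpolyXt mevalXU FE.
- by rewrite rmorphD mevalD mpolyCD /= IHp IHr.
- by rewrite rmorphM mevalM mpolyCM /= IHp IHr.
Qed.

(** * The kernel of a parameterization *)

Definition pt3 (K : fieldType) (x y z : K) : 'rV[K]_3 :=
  \row_i (if i == ord0 then x else if i == mid3 then y else z).

Lemma irreducible_mpoly_neq0 (K : fieldType) n (f : {mpoly K[n.+1]}) :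
  irreducible_mpoly f -> f != 0.
Proof.
move=> [_ f_irr]; apply/eqP => f0.
have [X_u|] : 'X_ord0 \is a @GRing.unit {mpoly K[n.+1]} \/
    0 \is a @GRing.unit {mpoly K[n.+1]} by apply: f_irr; rewrite f0 mulr0.
  have /mpoly_unitP[c _ /(congr1 (mcoeff U_(ord0)))] := X_u.
  by rewrite mcoeffXU mcoeffC mnm1_eq0 mulr0 => /eqP; rewrite oner_eq0.
by rewrite unitr0.
Qed.

Section CurveIdeal.

Variable K : closedFieldType.
Implicit Types (a : 'rV[K]_2) (p f g : {mpoly K[3]}).

(** The form on the line joining (a_1 : a_2 : 0) to (0 : 0 : 1), with X_3 as parameter. At a = 0
    only the point (0 : 0 : 1) remains. *)
Definition restrict a p : {poly K} := map_poly (meval (a 0)) (uni p).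

Lemma restrictM a : {morph restrict a : p q / p * q}.
Proof. by move=> p q; rewrite /restrict uniM rmorphM. Qed.

Lemma restrictD a : {morph restrict a : p q / p + q}.
Proof. by move=> p q; rewrite /restrict uniD rmorphD. Qed.

Lemma restrict_emb3C a c : restrict a (emb3 c%:P) = (c.@[a 0])%:P.
Proof. by rewrite /restrict uni_emb3C map_polyC. Qed.

Lemma restrict_horner a p s :
  (restrict a p).[s] = p.@[pt3 (a 0 ord0) (a 0 ord_max) s 0].
Proof.
elim/mpoly_ring_ind: p => [c|i|p q IHp IHq|p q IHp IHq].
- by rewrite /restrict uniC map_polyC hornerC /= !mevalC.
- rewrite mevalXU mxE /restrict; case: (ord3P i) => ->.
  + by rewrite uniX0 map_polyC hornerC /= mevalXU.
  + by rewrite uniX1 map_polyC hornerC /= mevalXU.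
  + by rewrite uniX2 map_polyX hornerX.
- by rewrite restrictD hornerD mevalD; congr (_ + _).
- by rewrite restrictM hornerM mevalM; congr (_ * _).
Qed.

(** Each coefficient of [p] as a polynomial in X_3 is a form in X_1, X_2 vanishing at [a], hence
    divisible by [lform a]. *)
Lemma restrict_eq0 D a p : p \is D.-homog -> a != 0 -> restrict a p = 0 ->
  exists r, p = emb3 (lform a)%:P * r.
Proof.
move=> p_D a0 pa0.
have coefP (i : 'I_(size (uni p))) : exists c, (uni p)`_i = lform a * c.
  have [iD|Di] := leqP i D; last first.
    by exists 0; rewrite mulr0 (uni_homog_gt p_D Di).
  have pi_homog := uni_homog p_D (subnKC iD).
  apply: binary_form_root pi_homog a0 _.
  by have := congr1 (fun u : {poly K} => u`_i) pa0; rewrite coef_map coef0.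
have [q qE] := fin_all_exists coefP.
pose u := \sum_(i < size (uni p)) (q i)%:P * 'X^i.
exists (emb3 u); rewrite -emb3M; apply: uni_inj; rewrite emb3K.
rewrite -[LHS]coefK poly_def big_distrr; apply: eq_bigr => i _ /=.
by rewrite qE -mul_polyC polyCM mulrA.
Qed.

(** [c] is a product of linear forms and the target is a domain, so one of the factors already
    vanishes after substitution. *)
Lemma binary_form_kernel k n (c : {mpoly K[2]}) (H : 2.-tuple {mpoly K[n]}) :
  c \is k.-homog -> c != 0 -> c \mPo H = 0 ->
  exists2 a, a != 0 & lform a \mPo H = 0.
Proof.
elim: k c => [|k IHk] c c_k c0 cH.
  have [x cE] := dhomog0_const c_k; move/eqP: cH.
  by rewrite cE comp_mpolyC mpolyC_eq0 -(mpolyC_eq0 2) -cE (negPf c0).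
have [a [c' [a0 c'_k cE]]] := binary_form_split c_k.
have c'0 : c' != 0 by apply: contraNneq c0 => c'0; rewrite cE c'0 mulr0.
move/eqP: cH; rewrite cE comp_mpolyM mulf_eq0 => /orP[]/eqP; first by exists a.
exact: IHk.
Qed.

Lemma lform_comp_eq0 n a (H : 2.-tuple {mpoly K[n]}) : a != 0 ->
  lform a \mPo H = 0 -> exists q, forall i, tnth H i = a 0 i *: q.
Proof.
move=> a0; rewrite /lform raddfB /= !comp_mpolyZ !comp_mpolyXt => /eqP.
rewrite subr_eq0 => /eqP HE.
move: a0; rewrite row2_neq0 => /orP[] ai0.
  exists ((a 0 ord0)^-1 *: tnth H ord0) => i; rewrite scalerA.
  case: (ord2P i) => ->; first by rewrite divff ?scale1r.
  by rewrite mulrC -scalerA HE scalerA mulVf ?scale1r.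
exists ((a 0 ord_max)^-1 *: tnth H ord_max) => i; rewrite scalerA.
case: (ord2P i) => ->; last by rewrite divff ?scale1r.
by rewrite mulrC -scalerA -HE scalerA mulVf ?scale1r.
Qed.

(** Such a [phi] is a constant map: G(phi) is q^k times the constant vector G(v), whereas the
    entries of h (X_1, X_2) satisfy no linear relation. *)
Lemma identity_map_nonconst k (G : 2.-tuple {mpoly K[3]})
    (phi : 3.-tuple {mpoly K[2]}) (v : 'I_3 -> K) q :
  forms_of_degree k G -> (forall i, tnth phi i = v i *: q) ->
  ~ identity_map (comp_forms G phi).
Proof.
move=> G_k phiE [h h0 hE].
pose F : 3.-tuple {mpoly K[2]} := [tuple (v i)%:MP | i < 3].
have GE i : (tnth G i).@[v] *: q ^+ k = h * 'X_i.
  have FE j : tnth phi j = q * tnth F j.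
    by rewrite tnth_mktuple mulrC mul_mpolyC.
  rewrite -hE comp_formsE (comp_scaled (G_k i) FE).
  rewrite (@comp_const _ _ _ _ _ v) 1?mulrC ?mul_mpolyC // => j.
  by rewrite tnth_mktuple.
pose b : 'rV[K]_2 := pt2 (tnth G ord0).@[v] (tnth G ord_max).@[v].
have lb : lform b = 0.
  apply: (mulfI h0); rewrite mulr0 /lform mulrBr -!scalerAr -!GE !scalerA.
  by rewrite !mxE /= mulrC subrr.
have b0 : b = 0 by apply/eqP/contraT => /lform_neq0; rewrite lb eqxx.
have := GE ord0; have -> : (tnth G ord0).@[v] = 0.
  by have := congr1 (fun r : 'rV_2 => r 0 ord0) b0; rewrite !mxE.
move=> /esym/eqP; rewrite scale0r mulf_eq0 (negPf h0) /=.
by rewrite -msize_poly_eq0 msizeX.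
Qed.

Section Kernel.

Variables (k : nat) (phi : 3.-tuple {mpoly K[2]}) (G : 2.-tuple {mpoly K[3]}).
Hypothesis (G_k : forms_of_degree k G).
Hypothesis (Gphi : identity_map (comp_forms G phi)).

Let phi01 := [tuple tnth phi ord0; tnth phi mid3].

Lemma emb3C_comp c : emb3 c%:P \mPo phi = c \mPo phi01.
Proof. by rewrite emb3_comp subst3C. Qed.

(* If (phi_1, phi_2) is a scalar multiple of one form, the kernel of
   substitution by phi is generated by a linear form. *)
Lemma curve_ideal_dependent a d D f g : a != 0 -> lform a \mPo phi01 = 0 ->
  f \is d.-homog -> irreducible_mpoly f -> f \mPo phi = 0 ->
  g \is D.-homog -> g \mPo phi = 0 -> exists q, g = q * f.
Proof.
move=> a0 la f_d [f_nu f_irr] f0 g_D g0.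
have [psi psiE] := lform_comp_eq0 a0 la.
have kerE D' p : p \is D'.-homog -> p \mPo phi = 0 ->
    exists r, p = emb3 (lform a)%:P * r.
  move=> p_D p0; apply: (restrict_eq0 p_D a0); apply: poly_vanish => s.
  rewrite restrict_horner.
  (* [phi] is [S] applied to (psi, phi_3), so it maps into the line that [S] parameterizes. If [p]
     did not vanish on this line, [p \mPo S] would be a relation making psi and phi_3 proportional,
     and [phi] would be constant. *)
  pose S : 3.-tuple {mpoly K[2]} :=
    [tuple a 0 ord0 *: 'X_ord0; a 0 ord_max *: 'X_ord0; 'X_ord_max].
  have S_1 : forms_of_degree 1 S.
    by move=> i; case: (ord3P i) => ->; rewrite ?dhomogXU // rpredZ ?dhomogXU.
  have SE : comp_forms S [tuple psi; tnth phi ord_max] = phi.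
    apply: eq_from_tnth => i; rewrite comp_formsE.
    case: (ord3P i) => ->; rewrite ?comp_mpolyZ ?comp_mpolyXt //.
      exact: esym (psiE ord0).
    exact: esym (psiE ord_max).
  have pS_D := dhomog_comp p_D S_1.
  have [pS0|pS0] := eqVneq (p \mPo S) 0.
    have := congr1 (fun c => c.@[pt2 1 s 0]) pS0; rewrite meval0 => <-.
    apply/esym/meval_comp => i; rewrite mxE.
    by case: (ord3P i) => ->; rewrite /= ?mevalZ mevalXU !mxE ?mulr1.
  have [|b b0 lb] := binary_form_kernel pS_D pS0 (H := [tuple psi; tnth phi ord_max]).
    by rewrite comp_mpolyA SE.
  have [chi chiE] := lform_comp_eq0 b0 lb.
  case: (@identity_map_nonconst k G phi
    (pt3 (a 0 ord0 * b 0 ord0) (a 0 ord_max * b 0 ord0) (b 0 ord_max) 0) chi) => //.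
  have psi_chi : psi = b 0 ord0 *: chi by exact: chiE ord0.
  move=> i; rewrite mxE; case: (ord3P i) => -> /=.
  - by rewrite (psiE ord0 : tnth phi ord0 = _) psi_chi scalerA.
  - by rewrite (psiE ord_max : tnth phi mid3 = _) psi_chi scalerA.
  - exact: chiE ord_max.
have [r fE] := kerE _ _ f_d f0; have [s gE] := kerE _ _ g_D g0.
have [/mpoly_unitP[c c0 lE]|/mpoly_unitP[c c0 rE]] := f_irr _ _ fE.
  have := congr1 (restrict a) lE; rewrite restrict_emb3C lform_root.
  rewrite /restrict uniC map_polyC /= mevalC => /esym/eqP.
  by rewrite !polyC_eq0 (negPf c0).
exists (c^-1 *: s); rewrite gE fE rE [_ * c%:MP]mulrC mul_mpolyC.
by rewrite -scalerAl -scalerAr scalerA mulVf // scale1r mulrC.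
Qed.

Lemma exists_min (P : nat -> Prop) :
  (exists n, P n) -> exists2 n, P n & forall m, P m -> (n <= m)%N.
Proof.
move=> [n]; elim/ltn_ind: n => n IHn Pn.
have [[m m_lt Pm]|min_n] := classic (exists2 m, (m < n)%N & P m).
  exact: IHn Pm.
exists n => // m Pm; rewrite leqNgt; apply/negP => m_lt.
by apply: min_n; exists m.
Qed.

Section Independent.

Hypothesis phi01_free : forall a, a != 0 -> lform a \mPo phi01 != 0.

Let ker D p := [/\ p \is D.-homog, p != 0 & p \mPo phi = 0].

(** Pseudo-division in X_3: multiplying [g] by the leading coefficient of [p] lets its leading term
    be cancelled by a multiple of [p]. The remainder stays homogeneous and in the kernel, so by
    minimality of [p] it can be divided again until it is 0. *)
Lemma ker_pseudo_div D p :
  ker D p ->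
  (forall D' p', ker D' p' -> (size (uni p) <= size (uni p'))%N) ->
  forall D' g, g \is D'.-homog -> g \mPo phi = 0 -> exists j c q,
    [/\ c \is j.-homog, c != 0 & emb3 c%:P * g = q * p].
Proof.
move=> [p_D p0 zp] p_min D' g.
have [n] := ubnP (size (uni g)); elim: n D' g => [//|n IHn] D' g gn g_D' zg.
have [->|g0] := eqVneq g 0.
  exists 0, 1, 0; split; [exact: dhomog1|exact: oner_neq0|].
  by rewrite mulr0 mul0r.
have mu0 (r : {mpoly K[3]}) : r != 0 -> uni r != 0.
  by apply: contraNneq => r0; rewrite -(uniK r) r0 -[X in _ == X]uniK uni0.
have sz_pg : (size (uni p) <= size (uni g))%N by apply: (p_min D').
set m := (size (uni p)).-1; set l := (size (uni g)).-1.
have pm : size (uni p) = m.+1 by rewrite -polySpred // mu0.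
have gl : size (uni g) = l.+1 by rewrite -polySpred // mu0.
have ml : (m <= l)%N by rewrite pm gl in sz_pg.
have le_deg (r : {mpoly K[3]}) D0 : r \is D0.-homog -> r != 0 -> ((size (uni r)).-1 <= D0)%N.
  move=> r_D r0; rewrite leqNgt; apply/negP => /(uni_homog_gt r_D) /eqP.
  by rewrite -[_`__]/(lead_coef _) lead_coef_eq0 (negPf (mu0 _ r0)).
have mD := le_deg _ _ p_D p0; have lD := le_deg _ _ g_D' g0.
set cp := (uni p)`_m; set cg := (uni g)`_l.
have cp_homog := uni_homog p_D (subnKC mD); rewrite -/m -/cp in cp_homog.
have cg_homog := uni_homog g_D' (subnKC lD); rewrite -/l -/cg in cg_homog.
have cp0 : cp != 0 by rewrite -[cp]/(lead_coef (uni p)) lead_coef_eq0 mu0.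
pose t := emb3 cg%:P * 'X_ord_max ^+ (l - m).
pose g' := emb3 cp%:P * g - t * p.
have g'_homog : g' \is (D - m + D').-homog.
  apply: rpredB; first by apply: dhomogM => //; apply: emb3_homog.
  rewrite /t (_ : D - m + D' = (D' - l) + 1 * (l - m) + D)%N.
    apply: dhomogM => //; apply: dhomogM; first exact: emb3_homog.
    by apply: dhomogMn; apply: dhomogXU.
  apply/eqP; rewrite mul1n -(eqn_add2r m) -addnA [(D' + m)%N]addnC addnA subnK //.
  by rewrite -!addnA [(D + m)%N]addnC !addnA -[(_ + (l - m) + m)%N]addnA subnK // subnK // addnC.
have zg' : g' \mPo phi = 0.
  by rewrite /g' comp_mpolyB [X in X - _]comp_mpolyM zg mulr0 comp_mpolyM zp mulr0 subrr.
have g'n : (size (uni g') < n)%N.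
  rewrite gl ltnS in gn; apply: leq_trans gn; rewrite ltnS.
  have muE : uni g' = cp%:P * uni g - cg%:P * 'X^(l - m) * uni p.
    by rewrite /g' uniB uniM uni_emb3C uniM /t uniM uni_emb3C uniXn uniX2.
  apply/leq_sizeP => j; rewrite leq_eqVlt muE coefB coefCM -mulrA coefCM coefXnM.
  move=> /orP[/eqP <-|lj].
    by rewrite ltnNge leq_subr /= subKn // mulrC subrr.
  rewrite (nth_default _ (_ : size (uni g) <= j)%N) ?gl // mulr0.
  rewrite ltnNge (leq_trans (leq_subr _ _) (ltnW lj)) /=.
  rewrite (nth_default _ (_ : size (uni p) <= _)%N) ?mulr0 ?subrr //.
  by rewrite pm ltn_subRL subnK.
have [j [c [q [c_j c0 cE]]]] := IHn _ _ g'n g'_homog zg'.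
exists (j + (D - m))%N, (c * cp), (q + emb3 c%:P * t); split.
- exact: dhomogM.
- exact: mulf_neq0.
- by rewrite polyCM emb3M mulrDl -cE /g' mulrBr -!mulrA subrK.
Qed.

(* The generator p has the least degree in X_3, then the least degree. By
   pseudo-division c g = q p with c a form in X_1, X_2; the linear factors of c
   can be cancelled one by one, since by minimality none of them divides p. *)
Lemma kernel_principal D f : ker D f -> exists D' p, ker D' p /\
  forall D'' g, g \is D''.-homog -> g \mPo phi = 0 -> exists q, g = q * p.
Proof.
move=> kf.
have [n [D1 [p1 k1 sz1]] n_min] : exists2 n,
    (exists D', exists2 p, ker D' p & size (uni p) = n) & forall m,
    (exists D', exists2 p, ker D' p & size (uni p) = m) -> (n <= m)%N.
  by apply: exists_min; exists (size (uni f)), D, f.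
have [D' [p kp sz] D_min] : exists2 D',
    (exists2 p, ker D' p & size (uni p) = n) & forall E,
    (exists2 p, ker E p & size (uni p) = n) -> (D' <= E)%N.
  by apply: exists_min; exists D1, p1.
exists D', p; split=> // D'' g g_D g0.
have p_min E p' : ker E p' -> (size (uni p) <= size (uni p'))%N.
  by move=> kp'; rewrite sz; apply: n_min; exists E, p'.
have [j [c [q [c_j c0 cE]]]] := ker_pseudo_div kp p_min g_D g0.
have [p_D p0 zp] := kp.
elim: j c q c_j c0 cE => [|j IHj] c q c_j c0 cE.
  have [x xE] := dhomog0_const c_j; exists (x^-1 *: q).
  have x0 : x != 0 by rewrite -(mpolyC_eq0 2) -xE.
  rewrite -scalerAl -cE xE -uniC uniK mul_mpolyC scalerA mulVf //.
  by rewrite scale1r.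
have [a [c' [a0 c'_j c'E]]] := binary_form_split c_j.
have c'0 : c' != 0 by apply: contraNneq c0 => c'0; rewrite c'E c'0 mulr0.
have l0 : emb3 (lform a)%:P != 0.
  by apply: contraNneq (phi01_free a0) => l0; rewrite -emb3C_comp l0 comp_mpoly0.
have cE' : emb3 (lform a)%:P * (emb3 c'%:P * g) = q * p.
  by rewrite -cE c'E polyCM emb3M mulrA.
have la0 : restrict a (emb3 (lform a)%:P) = 0.
  by rewrite restrict_emb3C lform_root.
(* [lform a] acts as a prime: restriction to the line it defines takes values in a domain, and
   [lform a] divides every form restricting to 0. *)
have : restrict a q * restrict a p = 0.
  by rewrite -restrictM -cE' restrictM la0 mul0r.
move=> /eqP; rewrite mulf_eq0 => /orP[]/eqP ra0; last first.
  have [r pE] := restrict_eq0 p_D a0 ra0.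
  have r0 : r != 0 by apply: contraNneq p0 => r0; rewrite pE r0 mulr0.
  have [i [E [l_i r_E D'E]]] : exists i E, [/\ emb3 (lform a)%:P \is i.-homog,
      r \is E.-homog & D' = (i + E)%N].
    by apply: dhomog_factor; rewrite -pE.
  move: D'E; rewrite (dhomog_uniq l0 l_i (emb3_homog (lform_homog a))).
  move=> D'E; have : (D' <= E)%N; last by rewrite D'E add1n ltnn.
  apply: D_min; exists r; last first.
    by rewrite -sz pE uniM uni_emb3C size_Cmul // lform_neq0.
  split=> //; move/eqP: zp; rewrite pE comp_mpolyM emb3C_comp mulf_eq0.
  by rewrite (negPf (phi01_free a0)) => /eqP.
have q_homog : q = 0 \/ exists E, q \is E.-homog.
  have [|q0] := eqVneq q 0; [by left|right].
  have [||i [E [q_i _ _]]] := @dhomog_factor _ _ (j.+1 + D'') q p.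
  - by rewrite -cE; apply: dhomogM => //; apply: emb3_homog.
  - by rewrite mulf_neq0.
  by exists i.
have [q' qE] : exists q', q = emb3 (lform a)%:P * q'.
  case: q_homog => [->|[E q_E]]; first by exists 0; rewrite mulr0.
  exact: restrict_eq0 q_E a0 ra0.
apply: (IHj c' q') => //; apply: (mulfI l0).
by rewrite cE' qE mulrA.
Qed.

End Independent.

(** The generator [p] vanishes under [phi], so it is no unit, and irreducibility makes the cofactor
    of [p] in [f] a unit. Proportional phi_1, phi_2 are treated apart because cancelling linear
    factors requires that none of them vanish under [phi]. *)
Lemma curve_ideal d D f g : f \is d.-homog -> irreducible_mpoly f ->
  f \mPo phi = 0 -> g \is D.-homog -> g \mPo phi = 0 -> exists q, g = q * f.
Proof.
move=> f_d f_irr f0 g_D g0.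
have [[a a0 la]|phi01_dep] :=
  classic (exists2 a, a != 0 & lform a \mPo phi01 = 0).
  exact: curve_ideal_dependent a0 la f_d f_irr f0 g_D g0.
have phi01_free a : a != 0 -> lform a \mPo phi01 != 0.
  by move=> a0; apply/eqP => la; apply: phi01_dep; exists a.
have [f_nu fP] := f_irr.
have fnz := irreducible_mpoly_neq0 f_irr.
have [E [p [[_ _ zp] pP]]] := kernel_principal phi01_free (And3 f_d fnz f0).
have [s fE] := pP _ _ f_d f0; have [r gE] := pP _ _ g_D g0.
have [s_u|p_u] := fP _ _ fE; last by have := comp_unit phi p_u; rewrite zp eqxx.
by exists (r / s); rewrite gE fE mulrA divrK.
Qed.

End Kernel.

End CurveIdeal.

(** * Monoidal curves A X_3 + B *)

Lemma proportional_same_point (K : fieldType) n (w x : 'rV[K]_n) :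
  w != 0 -> x != 0 -> (forall i j, w 0 i * x 0 j = w 0 j * x 0 i) ->
  same_point w x.
Proof.
move=> w0 /rV0Pn[j xj] wx.
have wE : w = (w 0 j / x 0 j) *: x.
  by apply/rowP => i; rewrite mxE mulrAC -wx mulfK.
exists (w 0 j / x 0 j) => //.
by apply: contraNneq w0 => c0; rewrite wE c0 scale0r.
Qed.

Lemma vanishes_same_point (K : fieldType) n d (g : {mpoly K[n]}) (x y : 'rV[K]_n) :
  g \is d.-homog -> same_point x y -> vanishes_at g y -> vanishes_at g x.
Proof.
move=> g_d [c c0 ->]; rewrite /vanishes_at => gy.
rewrite (@meval_scaled _ _ d c g (y 0)) ?gy ?mulr0 // => i.
by rewrite mxE.
Qed.

Lemma eval_comp (K : fieldType) m n (g : {mpoly K[m]}) (F : m.-tuple {mpoly K[n]})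
    (x : 'rV[K]_n) : g.@[eval_forms F x 0] = (g \mPo F).@[x 0].
Proof. by apply/esym/meval_comp => i; rewrite mxE. Qed.

Lemma derivation_comp (R : idomainType) n k (delta : {mpoly R[k]} -> {mpoly R[k]})
    (p : {mpoly R[n]}) (F : n.-tuple {mpoly R[k]}) :
  {morph delta : u v / u + v} ->
  (forall u v, delta (u * v) = delta u * v + u * delta v) ->
  (forall c, delta c%:MP = 0) -> (forall i, delta (tnth F i) = 0) ->
  delta (p \mPo F) = 0.
Proof.
move=> dD dM dC dF; elim/mpoly_ring_ind: p => [c|i|p q IHp IHq|p q IHp IHq].
- by rewrite comp_mpolyC dC.
- by rewrite comp_mpolyXt dF.
- by rewrite comp_mpolyD dD IHp IHq addr0.
- by rewrite comp_mpolyM dM IHp IHq mul0r mulr0 addr0.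
Qed.

Lemma linear_poly_dvd (R : nzRingType) (a b c : R) (u : {poly R}) :
  a%:P * 'X + b%:P = c%:P * u -> a = c * u`_1 /\ b = c * u`_0.
Proof.
move=> uE; rewrite -!coefCM -uE !coefD !coefMX !coefC /=.
by rewrite addr0 add0r.
Qed.

Section Parameterizations.

Variable K : closedFieldType.
Implicit Types (f g : {mpoly K[3]}) (A B : {mpoly K[2]}).

Lemma param_comp_eq0 d e f (phi : 3.-tuple {mpoly K[2]}) :
  f \is d.-homog -> forms_of_degree e phi ->
  (forall t : 'rV[K]_2, t != 0 -> vanishes_at f (eval_forms phi t)) ->
  f \mPo phi = 0.
Proof.
move=> f_d phi_e f0; apply: (binary_form_vanish (dhomog_comp f_d phi_e)).
by move=> t t0; rewrite -eval_comp; apply: f0.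
Qed.

Lemma comp_param e (phi : 3.-tuple {mpoly K[2]}) (G : 2.-tuple {mpoly K[3]}) h :
  forms_of_degree e phi -> (forall i, tnth (comp_forms G phi) i = h * 'X_i) ->
  forall i, (tnth phi i \mPo G) \mPo phi = h ^+ e * tnth phi i.
Proof.
move=> phi_e hE i; rewrite comp_mpolyA.
rewrite (@comp_scaled _ _ _ e h _ [tuple 'X_i | i < 2]) ?comp_mpoly_id //.
by move=> l; rewrite hE tnth_mktuple.
Qed.

Section Cross.

Variables (d e k : nat) (f : {mpoly K[3]}) (phi : 3.-tuple {mpoly K[2]}).
Variable (G : 2.-tuple {mpoly K[3]}).
Hypotheses (f_d : f \is d.-homog) (f_irr : irreducible_mpoly f).
Hypotheses (phi_e : forms_of_degree e phi) (G_k : forms_of_degree k G).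
Hypotheses (f0 : f \mPo phi = 0) (Gphi : identity_map (comp_forms G phi)).

(** The 2 x 2 minors of phi(G) and X: all of them vanish at x exactly when phi(G(x)) and x are
    linearly dependent. *)
Definition cross i j : {mpoly K[3]} :=
  (tnth phi i \mPo G) * 'X_j - (tnth phi j \mPo G) * 'X_i.

Lemma cross_dvd i j : exists q, cross i j = q * f.
Proof.
have [h h0 hE] := Gphi.
have phiG := comp_param phi_e hE.
apply: (curve_ideal G_k Gphi f_d f_irr f0 (D := (k * e + 1)%N)).
  by apply: rpredB; apply: dhomogM (dhomogXU _ _); apply: dhomog_comp.
rewrite /cross comp_mpolyB !comp_mpolyM !comp_mpolyXt !phiG.
by rewrite mulrAC subrr.
Qed.

Lemma parameterizableI : no_common_factor phi -> parameterizable G f.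
Proof.
move=> phi_cop; exists e, phi; split=> //.
  by move=> t _; rewrite /vanishes_at eval_comp f0 meval0.
move=> x x0 fx Gx; apply: proportional_same_point => //.
  exact: no_common_root phi_e phi_cop Gx.
move=> i j; have [q /(congr1 (meval (x 0)))] := cross_dvd i j.
rewrite mevalM (fx : f.@[x 0] = 0) mulr0 /cross mevalB !mevalM !mevalXU.
by rewrite -!eval_comp => /eqP; rewrite subr_eq0 !mxE => /eqP.
Qed.

End Cross.

Definition lin3 A B : {mpoly K[3]} := emb3 (A%:P * 'X + B%:P).

Definition lin3_param A B : 3.-tuple {mpoly K[2]} :=
  [tuple A * 'X_ord0; A * 'X_ord_max; - B].

Lemma lin3E A B : lin3 A B = emb3 A%:P * 'X_ord_max + emb3 B%:P.
Proof. by rewrite /lin3 emb3D emb3M emb3X. Qed.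

Lemma emb3CE A : emb3 A%:P = A \mPo [tuple 'X_ord0; 'X_mid3].
Proof. by rewrite /emb3 subst3C !tnth_mktuple. Qed.

Lemma emb3C_eval A (v : 'I_3 -> K) (w : 'I_2 -> K) :
  w ord0 = v ord0 -> w ord_max = v mid3 -> (emb3 A%:P).@[v] = A.@[w].
Proof.
move=> w0 w1; rewrite emb3CE; apply: meval_comp => i.
by case: (ord2P i) => ->; rewrite mevalXU.
Qed.

Lemma lin3_comp A B k (P : 3.-tuple {mpoly K[k]}) :
  let P01 := [tuple tnth P ord0; tnth P mid3] in
  lin3 A B \mPo P = (A \mPo P01) * tnth P ord_max + (B \mPo P01).
Proof.
rewrite /lin3 emb3_comp subst3D subst3M subst3X.
by congr (_ * _ + _); apply: subst3C.
Qed.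

Section Lin3.

Variables (j : nat) (A B : {mpoly K[2]}).
Hypotheses (A_j : A \is j.-homog) (B_j : B \is j.+1.-homog) (A0 : A != 0).

Lemma lin3_homog : lin3 A B \is j.+1.-homog.
Proof.
rewrite lin3E; apply: rpredD; last exact: emb3_homog.
by rewrite -(addn1 j); apply: dhomogM (emb3_homog A_j) (dhomogXU _ _).
Qed.

Lemma lin3_param_homog : forms_of_degree j.+1 (lin3_param A B).
Proof.
move=> i; case: (ord3P i) => ->; last by rewrite rpredN.
  by rewrite -(addn1 j); apply: dhomogM A_j (dhomogXU _ _).
by rewrite -(addn1 j); apply: dhomogM A_j (dhomogXU _ _).
Qed.

Lemma lin3_comp_param : lin3 A B \mPo lin3_param A B = 0.
Proof.
rewrite lin3_comp.
set P := [tuple _; _].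
have PE i : tnth P i = A * tnth [tuple 'X_i | i < 2] i.
  by rewrite tnth_mktuple; case: (ord2P i) => ->.
rewrite (comp_scaled A_j PE) (comp_scaled B_j PE) !comp_mpoly_id.
by rewrite -exprSr mulrN addNr.
Qed.

Lemma lin3_identity : 
  identity_map (comp_forms [tuple 'X_ord0; 'X_mid3] (lin3_param A B)).
Proof.
exists A => // i; rewrite comp_formsE.
by case: (ord2P i) => ->; rewrite comp_mpolyXt.
Qed.

(** The degree in X_3 is 1, so one of two factors is free of X_3; that factor divides both [A] and
    [B]. *)
Lemma lin3_irreducible :
  (forall h, (exists q, A = q * h) -> (exists q, B = q * h) ->
     h \is a GRing.unit) -> irreducible_mpoly (lin3 A B).
Proof.
move=> AB_cop.
have uniAB : uni (lin3 A B) = A%:P * 'X + B%:P by rewrite /lin3 emb3K.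
have sz : size (uni (lin3 A B)) = 2%N.
  by rewrite uniAB size_MXaddC polyC_eq0 (negPf A0) size_polyC A0.
have unitP g h : lin3 A B = g * h -> size (uni g) = 1%N -> g \is a GRing.unit.
  move=> gh /eqP/size_poly1P[a a0 gE].
  have AE : A%:P * 'X + B%:P = a%:P * uni h by rewrite -gE -uniM -gh uniAB.
  have /mpoly_unitP[c c0 aE] : a \is a GRing.unit.
    have [A1 B1] := linear_poly_dvd AE.
    by apply: AB_cop; [exists (uni h)`_1|exists (uni h)`_0]; rewrite mulrC.
  by apply/mpoly_unitP; exists c => //; rewrite -[g]uniK gE aE -uniC uniK.
split.
  apply/negP => /mpoly_unitP[c c0 cE]; move: sz.
  by rewrite cE uniC size_polyC mpolyC_eq0 c0.
move=> g h gh.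
have nz : uni g != 0 /\ uni h != 0.
  apply/andP; rewrite -negb_or -mulf_eq0 -uniM -gh.
  by rewrite -size_poly_eq0 sz.
case: nz => g0 h0; have := size_mul g0 h0; rewrite -uniM -gh sz.
rewrite (polySpred g0) (polySpred h0) addSn addnS /=.
case gs : (size (uni g)).-1 => [|[|m]]; case hs : (size (uni h)).-1 => [|[|l]] //.
  by move=> _; left; apply: unitP gh _; rewrite (polySpred g0) gs.
by move=> _; right; rewrite mulrC in gh; apply: unitP gh _; rewrite (polySpred h0) hs.
Qed.

End Lin3.

Lemma X01_coprime : no_common_factor [tuple 'X_ord0; 'X_mid3 : {mpoly K[3]}].
Proof.
move=> h hX; have [q qE] := hX ord0; have [r rE] := hX ord_max.
have X0 : q * h != 0 by rewrite -qE -msize_poly_eq0 msizeX.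
have qh_1 : q * h \is 1.-homog by rewrite -qE dhomogXU.
have [i [l [q_i h_l]]] := dhomog_factor qh_1 X0.
case: l h_l => [/dhomog0_const[c cE] _|l h_l].
  apply/mpoly_unitP; exists c => //.
  by apply: contraNneq X0 => c0; rewrite cE c0 mulr0.
case: i q_i => [/dhomog0_const[c cE] _|i _]; last by rewrite addSn addnS.
have c0 : c != 0 by apply: contraNneq X0 => c0; rewrite cE c0 mul0r.
(* Here [h] is proportional to X_1, so it vanishes at (0, 1, 0), where X_2 does not. *)
have := congr1 (meval (pt3 0 1 0 0)) qE; rewrite cE mevalM mevalC mevalXU mxE /=.
move=> /esym/eqP; rewrite mulf_eq0 (negPf c0) /= => /eqP h0.
have := congr1 (meval (pt3 0 1 0 0)) rE; rewrite mevalM mevalXU mxE /= h0 mulr0.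
by move=> /eqP; rewrite oner_eq0.
Qed.

End Parameterizations.

Lemma meval_mderivM0 (R : idomainType) n (p q : {mpoly R[n]}) v i :
  p.@[v] = 0 -> q.@[v] = 0 -> (mderiv i (p * q)).@[v] = 0.
Proof. by move=> p0 q0; rewrite mderivM mevalD !mevalM p0 q0 mulr0 mul0r addr0. Qed.

Lemma meval_MD0 (R : idomainType) n (p q r : {mpoly R[n]}) v :
  p.@[v] = 0 -> q.@[v] = 0 -> (p * r + q).@[v] = 0.
Proof. by move=> p0 q0; rewrite mevalD mevalM p0 q0 mul0r addr0. Qed.

Lemma meval_mderivMD0 (R : idomainType) n (p q r : {mpoly R[n]}) v i :
  p.@[v] = 0 -> (mderiv i p).@[v] = 0 -> (mderiv i q).@[v] = 0 ->
  (mderiv i (p * r + q)).@[v] = 0.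
Proof.
move=> p0 dp0 dq0; rewrite mderivD mderivM !mevalD !mevalM p0 dp0 dq0.
by rewrite !mul0r !addr0.
Qed.

Lemma mderivXU (R : idomainType) n (i : 'I_n) : mderiv i ('X_i : {mpoly R[n]}) = 1.
Proof.
rewrite mderivX mnm1E eqxx scale1r [X in 'X_[X]](_ : _ = 0%MM) ?mpolyX0 //.
by apply/mnmP => j; rewrite mnmBE mnm0E subnn.
Qed.

Lemma mderivMD_eq (R : idomainType) n (p q r : {mpoly R[n]}) i :
  mderiv i p = 0 -> mderiv i q = 0 -> mderiv i r = 1 ->
  mderiv i (p * r + q) = p.
Proof.
move=> p0 q0 r1; rewrite mderivD mderivM p0 q0 r1.
by rewrite mul0r add0r mulr1 addr0.
Qed.

Section MonoidalCurves.

Variable K : closedFieldType.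

Lemma lin3_eval (A B : {mpoly K[2]}) (x : 'rV[K]_3) :
  (lin3 A B).@[x 0] = A.@[pt2 (x 0 ord0) (x 0 mid3) 0] * x 0 ord_max
                      + B.@[pt2 (x 0 ord0) (x 0 mid3) 0].
Proof.
rewrite lin3E mevalD mevalM mevalXU; congr (_ * _ + _);
  by apply: emb3C_eval; rewrite mxE.
Qed.

Lemma same_point001 (x : 'rV[K]_3) : x != 0 ->
  x 0 ord0 = 0 -> x 0 mid3 = 0 -> same_point x (pt001 K).
Proof.
move=> x0 x00 x01.
have xE : x = x 0 ord_max *: pt001 K.
  by apply/rowP => i; rewrite !mxE; case: (ord3P i) => ->;
    rewrite /= ?mulr0 ?mulr1.
exists (x 0 ord_max) => //.
by apply: contraNneq x0 => x02; rewrite xE x02 scale0r.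
Qed.

Lemma form_vanish001 k (c : {mpoly K[2]}) : c \is k.+1.-homog ->
  vanishes_at (emb3 c%:P) (pt001 K).
Proof.
move=> c_k; rewrite /vanishes_at.
rewrite (@emb3C_eval _ _ _ (fun=> 0)) ?mxE //.
exact: dhomog_meval0 c_k _ _.
Qed.

(** A form of degree at least 2 in X_1, X_2 is a product of two forms vanishing at (0 : 0 : 1), so
    the product rule suffices. *)
Lemma form_deriv_vanish001 k (c : {mpoly K[2]}) i : c \is k.+2.-homog ->
  vanishes_at (mderiv i (emb3 c%:P)) (pt001 K).
Proof.
move=> c_k; have [a [c' [_ c'_k ->]]] := binary_form_split c_k.
rewrite polyCM emb3M; apply: meval_mderivM0; last exact: form_vanish001 c'_k.
exact: form_vanish001 (lform_homog a).
Qed.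

Lemma mderiv_emb3C (c : {mpoly K[2]}) : mderiv ord_max (emb3 c%:P) = 0.
Proof.
rewrite emb3CE; apply: derivation_comp => [u v|u v|x|i].
- exact: mderivD.
- exact: mderivM.
- exact: mderivC.
- by case: (ord2P i) => ->; rewrite mderivX mnm1E scale0r.
Qed.

Lemma mderiv_lin3 (A B : {mpoly K[2]}) : mderiv ord_max (lin3 A B) = emb3 A%:P.
Proof.
rewrite lin3E; apply: mderivMD_eq; [exact: mderiv_emb3C|exact: mderiv_emb3C|].
exact: mderivXU.
Qed.

(** The derivative in X_3 is [A]. At a singular point [A] vanishes, hence also [B], and a nonzero
    (x_1, x_2) would be a common root of the entries of the parameterization. *)
Lemma lin3_only_singular j (A B : {mpoly K[2]}) :
  A \is j.+1.-homog -> B \is j.+2.-homog -> A != 0 ->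
  no_common_factor (lin3_param A B) ->
  only_singular_point (lin3 A B) (pt001 K).
Proof.
move=> A_j B_j A0 AB_cop.
have f001 : vanishes_at (lin3 A B) (pt001 K).
  rewrite lin3E; apply: meval_MD0; first exact: form_vanish001 A_j.
  exact: form_vanish001 B_j.
split.
  (* For [A] of degree 1 the curve is a conic, and only passing through the point is claimed. *)
  case: j A_j B_j => [|j] A_j B_j; [right|left]; split=> //.
    exact: lin3_homog.
  move=> i; rewrite lin3E; apply: meval_mderivMD0.
  - exact: form_vanish001 A_j.
  - exact: form_deriv_vanish001 A_j.
  - exact: form_deriv_vanish001 B_j.
move=> x x0 [fx /(_ ord_max)]; rewrite /vanishes_at mderiv_lin3 => Ax.
pose y := pt2 (x 0 ord0) (x 0 mid3).
have Ay : A.@[y 0] = 0 by rewrite -Ax; apply/esym/emb3C_eval; rewrite mxE.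
have By : B.@[y 0] = 0.
  by move: fx; rewrite /vanishes_at lin3_eval -/y Ay mul0r add0r.
have [y0|y0] := eqVneq y 0.
  apply: same_point001 => //.
    by have := congr1 (fun r : 'rV_2 => r 0 ord0) y0; rewrite !mxE.
  by have := congr1 (fun r : 'rV_2 => r 0 ord_max) y0; rewrite !mxE.
have := no_common_root (lin3_param_homog A_j B_j) AB_cop y0.
case/negP; apply/eqP/rowP => i; rewrite !mxE.
case: (ord3P i) => ->; rewrite ?mevalN ?By ?oppr0 //.
  by rewrite mevalM Ay mul0r.
by rewrite mevalM Ay mul0r.
Qed.

Lemma lin3_coprime (A B : {mpoly K[2]}) : no_common_factor (lin3_param A B) ->
  forall h, (exists q, A = q * h) -> (exists q, B = q * h) ->
  h \is a GRing.unit.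
Proof.
move=> AB_cop h [q qE] [r rE]; apply: AB_cop => i.
case: (ord3P i) => ->.
- by exists (q * 'X_ord0); rewrite [LHS]/(A * 'X_ord0) qE mulrAC.
- by exists (q * 'X_ord_max); rewrite [LHS]/(A * 'X_ord_max) qE mulrAC.
- by exists (- r); rewrite [LHS]/(- B) rE mulNr.
Qed.

Lemma lin3_by_lines j (A B : {mpoly K[2]}) :
  A \is j.-homog -> B \is j.+1.-homog -> A != 0 ->
  no_common_factor (lin3_param A B) -> parameterizable_by_lines (lin3 A B).
Proof.
move=> A_j B_j A0 AB_cop; exists [tuple 'X_ord0; 'X_mid3].
have X_1 : forms_of_degree 1 [tuple 'X_ord0; 'X_mid3 : {mpoly K[3]}].
  by move=> i; case: (ord2P i) => ->; apply: dhomogXU.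
split=> //; first exact: X01_coprime.
apply: (@parameterizableI _ j.+1 j.+1 1 _ (lin3_param A B)) => //.
- exact: lin3_homog.
- exact: lin3_irreducible (lin3_coprime AB_cop).
- exact: lin3_param_homog.
- exact: lin3_comp_param A_j B_j.
- exact: lin3_identity.
Qed.

(* x is the image of its projection from (0 : 0 : 1), or is (0 : 0 : 1) itself,
   which is the image of any root of A. *)
Lemma lin3_point j (A B : {mpoly K[2]}) (x : 'rV[K]_3) :
  A \is j.+1.-homog -> B \is j.+2.-homog ->
  no_common_factor (lin3_param A B) -> x != 0 -> vanishes_at (lin3 A B) x ->
  exists2 y : 'rV[K]_2, y != 0 & same_point x (eval_forms (lin3_param A B) y).
Proof.
move=> A_j B_j AB_cop x0 fx; have P_j := lin3_param_homog A_j B_j.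
pose y := pt2 (x 0 ord0) (x 0 mid3).
have [y0|y0] := eqVneq y 0; last first.
  exists y => //; apply: proportional_same_point => //.
    exact: no_common_root P_j AB_cop y0.
  have yE : A.@[y 0] * x 0 ord_max = - B.@[y 0].
    by apply/eqP; rewrite -addr_eq0 -lin3_eval; apply/eqP.
  have PE i : (tnth (lin3_param A B) i).@[y 0] = A.@[y 0] * x 0 i.
    case: (ord3P i) => ->; rewrite ?mevalN ?yE //.
      by rewrite mevalM mevalXU !mxE.
    by rewrite mevalM mevalXU !mxE.
  by move=> i l; rewrite !mxE !PE mulrCA [RHS]mulrCA; congr (_ * _); apply: mulrC.
have [a a0 Aa] := binary_form_has_root A_j isT.
exists a => //; have Pa := no_common_root P_j AB_cop a0.
apply: proportional_same_point => //.
have x00 : x 0 ord0 = 0.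
  by have := congr1 (fun r : 'rV_2 => r 0 ord0) y0; rewrite !mxE.
have x01 : x 0 mid3 = 0.
  by have := congr1 (fun r : 'rV_2 => r 0 ord_max) y0; rewrite !mxE.
have P0 : (eval_forms (lin3_param A B) a) 0 ord0 = 0.
  by rewrite mxE mevalM Aa mul0r.
have P1 : (eval_forms (lin3_param A B) a) 0 mid3 = 0.
  by rewrite mxE mevalM Aa mul0r.
move=> i l; case: (ord3P i) => ->; case: (ord3P l) => ->;
  by rewrite ?x00 ?x01 ?P0 ?P1 ?mul0r ?mulr0.
Qed.

End MonoidalCurves.

(** * The direct implication *)

Section QuadraticTransformation.

Variable K : closedFieldType.

Lemma lin3_neq0 (A B : {mpoly K[2]}) : A != 0 -> lin3 A B != 0.
Proof.
move=> A0; apply: contraNneq A0 => l0.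
have := mderiv_lin3 A B; rewrite l0 mderiv0 => /(congr1 (@uni K)).
by rewrite uni_emb3C uni0 => /esym/eqP; rewrite polyC_eq0.
Qed.

Lemma comp_identity_map n D (H : 3.-tuple {mpoly K[n]}) (g : {mpoly K[3]})
    (G : n.-tuple {mpoly K[3]}) h :
  g \is D.-homog -> (forall i, tnth (comp_forms H G) i = h * 'X_i) ->
  (g \mPo H) \mPo G = h ^+ D * g.
Proof.
move=> g_D hE; rewrite comp_mpolyA.
rewrite (@comp_scaled _ _ _ D h _ [tuple 'X_i | i < 3]) ?comp_mpoly_id //.
by move=> i; rewrite hE tnth_mktuple.
Qed.

Variables (F1 F2 F3 : {mpoly K[3]}).
Hypothesis F_quad : quadratic_transformation [tuple F1; F2; F3].
Variables (d : nat) (f : {mpoly K[3]}).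
Hypotheses (f_d : f \is d.-homog) (f_irr : irreducible_mpoly f).
Hypothesis d_ge3 : (3 <= d)%N.

Let F := [tuple F1; F2; F3].
Let E := [tuple F1; F2].

Let F_2 : forms_of_degree 2 F. Proof. by case: F_quad. Qed.

Let E_2 : forms_of_degree 2 E.
Proof. by move=> i; case: (ord2P i) => ->; [apply: (F_2 ord0)|apply: (F_2 mid3)]. Qed.

Lemma image_param e (phi : 3.-tuple {mpoly K[2]}) :
  forms_of_degree e phi -> identity_map (comp_forms E phi) ->
  exists j A B g, [/\ A \is j.-homog /\ B \is j.+1.-homog, A != 0, g != 0,
    no_common_factor (lin3_param A B) &
    forall i, tnth F i \mPo phi = g * tnth (lin3_param A B) i].
Proof.
move=> phi_e [h h0 hE].
pose C := comp_forms F phi.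
have CE i : tnth C i = tnth F i \mPo phi by rewrite comp_formsE.
have C_e : forms_of_degree (e * 2) C.
  by move=> i; rewrite CE; apply: dhomog_comp (F_2 i) phi_e.
have C0E : tnth C ord0 = h * 'X_ord0 by rewrite CE -hE comp_formsE.
have C1E : tnth C mid3 = h * 'X_ord_max by rewrite CE -hE comp_formsE.
have X0 : 'X_ord0 != 0 :> {mpoly K[2]} by rewrite -msize_poly_eq0 msizeX.
have C0 : tnth C ord0 != 0 by rewrite C0E mulf_neq0.
have [e0 [g [P [P_e P_cop g0 PE]]]] := strip_common_factor C_e C0.
(* The stripped entries satisfy g P_i = h X_i for the first two indices, which is enough for P_i = A
   X_i. *)
have [||A A0 AE] := @identity_map_cancel K e0 [tuple tnth P ord0; tnth P mid3] g h _ g0 h0.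
- by move=> i; case: (ord2P i) => ->; apply: P_e.
- by move=> i; case: (ord2P i) => ->; rewrite -?C0E -?C1E PE.
have P0E : tnth P ord0 = A * 'X_ord0 by exact: AE ord0.
have P1E : tnth P mid3 = A * 'X_ord_max by exact: AE ord_max.
have AX_e : A * 'X_ord0 \is e0.-homog by rewrite -P0E.
have [|j [k [A_j X_k e0E]]] := dhomog_factor AX_e; first by rewrite mulf_neq0.
rewrite (dhomog_uniq X0 X_k (dhomogXU _ _)) addn1 in e0E.
have PlE : P = lin3_param A (- tnth P ord_max).
  apply: eq_from_tnth => i; case: (ord3P i) => ->; [exact: P0E|exact: P1E|].
  exact/esym/opprK.
exists j, A, (- tnth P ord_max), g; split=> //.
- by split=> //; rewrite rpredN -e0E; apply: P_e.
- by rewrite -PlE.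
- by move=> i; rewrite -PlE -PE CE.
Qed.

Lemma forward : parameterizable E f ->
  exists d0 f0, [/\ plane_curve d0 f0, parameterizable_by_lines f0,
    only_singular_point f0 (pt001 K) & forall p : 'rV[K]_3, p != 0 ->
      (zariski_closure (image_of_curve F f) p <-> vanishes_at f0 p)].
Proof.
move=> [e [phi [[phi_e phi_cop] phi_van Ephi phi_inv]]].
have fphi := param_comp_eq0 f_d phi_e phi_van.
have [j [A [B [g [[A_j B_j] A0 g0 P_cop gE]]]]] := image_param phi_e Ephi.
set P := lin3_param A B in P_cop gE.
have CE i : tnth (comp_forms F phi) i = g * tnth P i by rewrite comp_formsE gE.
have f0_j := lin3_homog A_j B_j.
have f0F_homog := dhomog_comp f0_j F_2.
have f0Fphi : (lin3 A B \mPo F) \mPo phi = 0.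
  by rewrite comp_mpolyA (comp_scaled f0_j CE) (lin3_comp_param A_j B_j) mulr0.
have [s sE] := curve_ideal E_2 Ephi f_d f_irr fphi f0F_homog f0Fphi.
case: j => [|j] in A_j B_j f0_j f0F_homog *.
  have f0F0 : lin3 A B \mPo F = 0.
    apply/eqP/contraT => f0F0.
    have sf_2 : s * f \is (2 * 1).-homog by rewrite -sE.
    have sf0 : s * f != 0 by rewrite -sE.
    have [i [k [_ f_k /eqP]]] := dhomog_factor sf_2 sf0.
    have f_neq0 := irreducible_mpoly_neq0 f_irr.
    rewrite (dhomog_uniq f_neq0 f_k f_d) => /eqP ikE.
    by move: (leq_addl i d); rewrite -ikE leqNgt d_ge3.
  (* Composing with the inverse [G] turns the vanishing into h (A X_3 + B) = 0; in other words
     Lambda_F does not map the plane into a line. *)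
  have [_ _ [dG [G [_ _ _ [h h0 hE]]]]] := F_quad.
  have := comp_identity_map f0_j hE; rewrite f0F0 comp_mpoly0 => /esym/eqP.
  by rewrite mulf_eq0 expf_eq0 (negPf h0) (negPf (lin3_neq0 B A0)).
exists j.+2, (lin3 A B); split.
- by split=> //; apply: lin3_irreducible (lin3_coprime P_cop).
- exact: lin3_by_lines A_j B_j A0 P_cop.
- exact: lin3_only_singular A_j B_j A0 P_cop.
move=> p p0; split.
  move=> p_cl; apply: (p_cl _ _ f0_j) => y [x [x0 fx Fx]] yFx; apply: vanishes_same_point f0_j yFx _.
  by rewrite /vanishes_at eval_comp sE mevalM (fx : f.@[x 0] = 0) mulr0.
move=> f0p D u u_D u_van.
have uF_homog := dhomog_comp u_D F_2.
have uFphi_homog := dhomog_comp uF_homog phi_e.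
have uP : u \mPo P = 0.
  have F0phi_homog := dhomog_comp (F_2 ord0) phi_e.
  (* The factor F_1(phi) = g A X_1 covers the parameters t at which Lambda_F is undefined at phi(t).
     It is nonzero, so it can be cancelled. *)
  have uFphi : (F1 \mPo phi) * ((u \mPo F) \mPo phi) = 0.
    apply: (binary_form_vanish (dhomogM F0phi_homog uFphi_homog)) => t t0.
    have x0 := no_common_root phi_e phi_cop t0.
    rewrite mevalM -!eval_comp.
    have [Fx0|Fx0] := eqVneq (eval_forms F (eval_forms phi t)) 0.
      have := congr1 (fun r : 'rV_3 => r 0 ord0) Fx0; rewrite !mxE => F1x.
      by rewrite (F1x : F1.@[_] = 0) mul0r.
    rewrite (u_van (eval_forms F (eval_forms phi t)) _ : u.@[_] = 0) ?mulr0 //.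
    exists (eval_forms phi t); split=> //; first exact: phi_van.
    by exists 1; rewrite ?oner_neq0 ?scale1r.
  move/eqP: uFphi; rewrite (gE ord0 : F1 \mPo phi = _) comp_mpolyA.
  rewrite (comp_scaled u_D CE) !mulf_eq0 expf_eq0 (negPf g0) (negPf A0) andbF /=.
  by rewrite -msize_poly_eq0 msizeX /= => /eqP.
have [y y0 py] := lin3_point A_j B_j P_cop p0 f0p.
apply: vanishes_same_point u_D py _.
by rewrite /vanishes_at eval_comp uP meval0.
Qed.

End QuadraticTransformation.

(** * Curves parameterizable by lines *)

Lemma dhomog1E (R : idomainType) n (p : {mpoly R[n]}) :
  p \is 1.-homog -> p = \sum_l p@_U_(l) *: 'X_l.
Proof.
move=> p1; apply/mpolyP => m; rewrite raddf_sum /=.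
have [/eqP|m1] := boolP (mdeg m == 1%N).
  move=> /eqP/mdeg1P[i /eqP ->]; rewrite (bigD1 i) //= big1 => [|l li].
    by rewrite mcoeffZ mcoeffX eqxx mulr1 addr0.
  by rewrite mcoeffZ mcoeffX eq_mnm1 (negPf li) mulr0.
rewrite (dhomog_nemf_coeff p1 m1) big1 // => l _.
rewrite mcoeffZ mcoeffX; case: eqP => [lm|]; last by rewrite mulr0.
by move: m1; rewrite -lm mdeg1.
Qed.

Lemma meval_mderivM0r (R : idomainType) n (p q : {mpoly R[n]}) v i :
  q.@[v] = 0 -> (mderiv i q).@[v] = 0 -> (mderiv i (p * q)).@[v] = 0.
Proof. by move=> q0 dq0; rewrite mderivM mevalD !mevalM q0 dq0 !mulr0 addr0. Qed.

Lemma mderivXUE (R : idomainType) n (i l : 'I_n) :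
  mderiv l ('X_i : {mpoly R[n]}) = (i == l)%:R.
Proof.
have [->|il] := eqVneq i l; first exact: mderivXU.
by rewrite mderivX mnm1E (negPf il) scale0r.
Qed.

Lemma meval_sum (R : idomainType) n (I : finType) (p : I -> {mpoly R[n]}) v :
  (\sum_i p i).@[v] = \sum_i (p i).@[v].
Proof. exact: (big_morph _ (mevalD v) (meval0 v)). Qed.

Lemma emb3N (R : idomainType) : {morph @emb3 R : u / - u}.
Proof.
move=> u; apply/eqP; rewrite -addr_eq0 -emb3D addNr.
by rewrite -uni0 uniK.
Qed.

Lemma size_linear_poly (R : nzRingType) (a b : R) :
  (size (a%:P * 'X + b%:P)%R <= 2)%N.
Proof.
rewrite size_MXaddC size_polyC; case: ifP => // _.
by case: (a != 0).
Qed.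

Lemma linear_polyE (R : nzRingType) (p : {poly R}) :
  (size p <= 2)%N -> p = (p`_1)%:P * 'X + (p`_0)%:P.
Proof.
move=> sz; apply/polyP => -[|[|i]]; rewrite coefD coefMX !coefC /= ?add0r ?addr0 //.
by rewrite nth_default // (leq_trans sz).
Qed.

Section Lines.

Variable K : closedFieldType.

Definition dir_deriv n (q : 'rV[K]_n) (p : {mpoly K[n]}) : {mpoly K[n]} :=
  \sum_l q 0 l *: mderiv l p.

Lemma dir_derivD n (q : 'rV[K]_n) : {morph dir_deriv q : u v / u + v}.
Proof.
move=> u v; rewrite /dir_deriv -big_split /=.
by apply: eq_bigr => l _; rewrite mderivD scalerDr.
Qed.

Lemma dir_derivB n (q : 'rV[K]_n) : {morph dir_deriv q : u v / u - v}.
Proof.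
move=> u v; rewrite /dir_deriv -sumrB.
by apply: eq_bigr => l _; rewrite mderivB scalerBr.
Qed.

Lemma dir_deriv0 n (q : 'rV[K]_n) : dir_deriv q 0 = 0.
Proof. by rewrite /dir_deriv big1 // => l _; rewrite mderiv0 scaler0. Qed.

Lemma dir_derivM n (q : 'rV[K]_n) u v :
  dir_deriv q (u * v) = dir_deriv q u * v + u * dir_deriv q v.
Proof.
rewrite /dir_deriv big_distrl big_distrr -big_split /=.
by apply: eq_bigr => l _; rewrite mderivM scalerDr scalerAl scalerAr.
Qed.

Lemma dir_derivC n (q : 'rV[K]_n) c : dir_deriv q c%:MP = 0.
Proof. by rewrite /dir_deriv big1 // => l _; rewrite mderivC scaler0. Qed.

Lemma dir_derivX n (q : 'rV[K]_n) i : dir_deriv q 'X_i = (q 0 i)%:MP.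
Proof.
rewrite /dir_deriv (bigD1 i) //= big1 => [|l li].
  by rewrite mderivXU addr0 -mul_mpolyC mulr1.
by rewrite mderivXUE eq_sym (negPf li) scaler0.
Qed.

Lemma dir_deriv_linear n (q : 'rV[K]_n) p : p \is 1.-homog ->
  dir_deriv q p = (p.@[q 0])%:MP.
Proof.
move=> p1; rewrite (dhomog1E p1) meval_sum (big_morph _ (@dir_derivD n q) (dir_deriv0 q)).
rewrite (big_morph _ (@mpolyCD n K) (@mpolyC0 n K)); apply: eq_bigr => l _.
rewrite -mul_mpolyC dir_derivM dir_derivC dir_derivX mul0r add0r.
by rewrite mevalM mevalC mevalXU mpolyCM.
Qed.

(** Two linear equations in three unknowns; the solution is the center of the projection given by
    [G]. *)
Lemma common_zero (G : 2.-tuple {mpoly K[3]}) : forms_of_degree 1 G ->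
  exists2 q : 'rV[K]_3, q != 0 & eval_forms G q = 0.
Proof.
move=> G_1; pose M : 'M[K]_(3, 2) := \matrix_(l, j) (tnth G j)@_U_(l).
have ker0 : kermx M != 0.
  by rewrite -mxrank_eq0 mxrank_ker -lt0n subn_gt0 ltnS rank_leq_col.
have /rowV0Pn[q /sub_kermxP qM q0] := ker0; exists q => //.
apply/rowP => j; have := congr1 (fun r : 'rV_2 => r 0 j) qM.
rewrite !mxE => <-; rewrite {1}(dhomog1E (G_1 j)) meval_sum.
by apply: eq_bigr => l _; rewrite mevalZ mevalXU mxE mulrC.
Qed.

(* f0 divides phi_i(G) X_j - phi_j(G) X_i, whose derivative along the direction
   q with G(q) = 0 is phi_i(G) q_j - phi_j(G) q_i, because phi_i(G) is constant
   along q. *)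
Lemma singular_is_center d0 (f0 : {mpoly K[3]}) (G : 2.-tuple {mpoly K[3]}) :
  f0 \is d0.-homog -> irreducible_mpoly f0 -> forms_of_degree 1 G ->
  parameterizable G f0 -> singular_point f0 (pt001 K) ->
  eval_forms G (pt001 K) = 0.
Proof.
move=> f0_d f0_irr G_1 [e [phi [[phi_e phi_cop] phi_van Gphi phi_inv]]] [fz dfz].
apply/eqP/contraT => Gz.
have z0 : pt001 K != 0.
  apply/negP => /eqP/(congr1 (fun r : 'rV_3 => r 0 ord_max)).
  by rewrite !mxE => /eqP; rewrite oner_eq0.
have [c c0 wE] := phi_inv _ z0 fz Gz.
have [q q0 Gq] := common_zero G_1.
have f0phi := param_comp_eq0 f0_d phi_e phi_van.
have dG i : dir_deriv q (tnth phi i \mPo G) = 0.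
  apply: derivation_comp => [||a|j].
  - exact: dir_derivD.
  - exact: dir_derivM.
  - exact: dir_derivC.
  rewrite dir_deriv_linear //.
  by have := congr1 (fun r : 'rV_2 => r 0 j) Gq; rewrite !mxE => ->; rewrite mpolyC0.
have phiG i : (tnth phi i \mPo G).@[pt001 K 0] = c * pt001 K 0 i.
  have := congr1 (fun r : 'rV_3 => r 0 i) wE.
  by rewrite mxE eval_comp [in RHS]mxE.
(* Every derivative of a multiple of [f0] vanishes at a singular point. Since phi(G) takes the value
   c p at p, this makes [q] proportional to p, so that G(p) = 0 after all. *)
have crossz i j : c * pt001 K 0 i * q 0 j = c * pt001 K 0 j * q 0 i.
  have [s sE] := cross_dvd f0_d f0_irr phi_e G_1 f0phi Gphi i j.
  have : (dir_deriv q (cross phi G i j)).@[pt001 K 0] = 0.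
    rewrite sE /dir_deriv meval_sum big1 //= => l _.
    by rewrite mevalZ (meval_mderivM0r _ fz (dfz l)) mulr0.
  rewrite /cross dir_derivB !dir_derivM !dir_derivX !dG !mul0r !add0r.
  rewrite mevalB !mevalM !mevalC !phiG => /eqP.
  by rewrite subr_eq0 => /eqP.
have qE j : q 0 j = q 0 ord_max * pt001 K 0 j.
  apply: (mulfI c0); have := crossz ord_max j.
  by rewrite mxE !eqxx mulr1 => ->; rewrite -mulrA [q 0 _ * _]mulrC.
have qmax0 : q 0 ord_max != 0.
  apply: contraNneq q0 => qmax; apply/eqP/rowP => j.
  by rewrite qE qmax mul0r mxE.
case/negP: Gz; apply/eqP/rowP => j; rewrite !mxE.
have := congr1 (fun r : 'rV_2 => r 0 j) Gq; rewrite !mxE => /eqP.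
rewrite (meval_scaled (c := q 0 ord_max) (v := pt001 K 0) (G_1 j) qE) expr1.
by rewrite mulf_eq0 (negPf qmax0) => /eqP.
Qed.

(** For i < D the coefficient of X_3^i has positive degree in X_1, X_2 and vanishes at 0; the
    coefficient of X_3^D is the value at (0 : 0 : 1). *)
Lemma restrict0E D (p : {mpoly K[3]}) : p \is D.-homog ->
  (restrict 0 p) = (p.@[pt001 K 0]) *: 'X^D.
Proof.
move=> p_D.
have coef_lt i : i != D -> (restrict 0 p)`_i = 0.
  rewrite /restrict coef_map /= neq_ltn => /orP[iD|Di]; last first.
    by rewrite (uni_homog_gt p_D Di) meval0.
  apply: (dhomog_meval0 (uni_homog p_D (subnKC (ltnW iD)))) => [|l].
    by rewrite subn_gt0.
  by rewrite mxE.
have rE : restrict 0 p = (restrict 0 p)`_D *: 'X^D.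
  apply/polyP => i; rewrite coefZ coefXn.
  by have [->|/coef_lt ->] := eqVneq i D; rewrite ?mulr1 ?mulr0.
rewrite {1}rE; congr (_ *: _).
have := congr1 (fun u : {poly K} => u.[1]) rE.
rewrite /= hornerZ hornerXn expr1n mulr1 restrict_horner => <-.
apply: meval_eq => i; rewrite !mxE; case: (ord3P i) => -> //.
Qed.

Lemma linear_form_vanish001 (p : {mpoly K[3]}) : p \is 1.-homog -> p.@[pt001 K 0] = 0 ->
  exists a, p = emb3 a%:P.
Proof.
move=> p_1 pz; have := restrict0E p_1; rewrite pz scale0r => r0.
have p1 : (uni p)`_1 = 0.
  have [c cE] := dhomog0_const (uni_homog p_1 (erefl : (1 + 0 = 1)%N)).
  have := congr1 (fun u : {poly K} => u`_1) r0.
  by rewrite /restrict coef_map coef0 /= cE mevalC => ->; rewrite mpolyC0.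
exists (uni p)`_0; rewrite -[LHS]uniK; congr emb3.
apply: size1_polyC; apply/leq_sizeP => -[|[|i]] // _.
exact: uni_homog_gt p_1 _.
Qed.

(* f0 divides phi_i(G) X_3 - phi_3(G) X_i, where phi(G) is free of X_3. *)
Lemma singular_size d0 (f0 : {mpoly K[3]}) :
  f0 \is d0.-homog -> irreducible_mpoly f0 -> parameterizable_by_lines f0 ->
  singular_point f0 (pt001 K) -> (size (uni f0) <= 2)%N.
Proof.
move=> f0_d f0_irr [G [G_1 G_cop Gf0]] f0z.
have Gz := singular_is_center f0_d f0_irr G_1 Gf0 f0z.
have [e [phi [[phi_e _] phi_van Gphi _]]] := Gf0.
have f0phi := param_comp_eq0 f0_d phi_e phi_van.
have gP j : exists a, tnth G j = emb3 a%:P.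
  apply: linear_form_vanish001 (G_1 j) _.
  by have := congr1 (fun r : 'rV_2 => r 0 j) Gz; rewrite !mxE.
have [g gE] := fin_all_exists gP.
pose u i := tnth phi i \mPo [tuple g j | j < 2].
have uE i : tnth phi i \mPo G = emb3 (u i)%:P.
  rewrite emb3CE comp_mpolyA; congr (_ \mPo _).
  by apply: eq_from_tnth => j; rewrite comp_formsE tnth_mktuple gE emb3CE.
have XE (i : 'I_3) : i != ord_max -> exists y : {mpoly K[2]}, 'X_i = emb3 y%:P.
  case: (ord3P i) => -> // _.
    by exists 'X_ord0; rewrite -uniX0 uniK.
  by exists 'X_ord_max; rewrite -uniX1 uniK.
have crossE i : i != ord_max -> exists y, cross phi G i ord_max = lin3 (u i) y.
  move=> /XE[y yE]; exists (- (u ord_max * y)).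
  rewrite lin3E; congr (_ * _ + _); first exact: uE.
  by rewrite polyCN emb3N polyCM emb3M; congr (- (_ * _)); [exact: uE|exact: yE].
have cross0 i : i != ord_max -> cross phi G i ord_max = 0 -> tnth phi i = 0.
  move=> /crossE[y ->] l0.
  have ui0 : u i = 0.
    by apply/eqP/contraT => /(@lin3_neq0 _ _ y); rewrite l0 eqxx.
  have [h h0 hE] := Gphi; have := comp_param phi_e hE i.
  rewrite uE ui0 emb3_comp subst3C comp_mpoly0 => /esym/eqP.
  by rewrite mulf_eq0 expf_eq0 (negPf h0) andbF => /eqP.
(* If both minors vanished, then phi_1 = phi_2 = 0 and [phi] would be the constant map to (0 : 0 :
   1). *)
have [i imax ci] : exists2 i, i != ord_max & cross phi G i ord_max != 0.
  apply: NNPP => no_i.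
  have phi0 i : i != ord_max -> tnth phi i = 0.
    move=> imax; apply: (cross0 _ imax); apply/eqP/contraT => ci.
    by case: no_i; exists i.
  apply: (@identity_map_nonconst K 1 G phi (pt3 0 0 1 0) (tnth phi ord_max)) => //.
  move=> i; rewrite mxE; case: (ord3P i) => -> /=.
  - by rewrite scale0r phi0.
  - by rewrite scale0r phi0.
  - by rewrite scale1r.
have [y yE] := crossE i imax.
have [s sE] := cross_dvd f0_d f0_irr phi_e G_1 f0phi Gphi i ord_max.
have usz : (size (uni (lin3 (u i) y)) <= 2)%N.
  by rewrite /lin3 emb3K size_linear_poly.
rewrite yE in ci sE.
have uni_neq0 (p : {mpoly K[3]}) : p != 0 -> uni p != 0.
  by apply: contraNneq => p0; rewrite -(uniK p) p0 -[X in _ == X]uniK uni0.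
have := uni_neq0 _ ci; rewrite sE uniM mulf_eq0 negb_or => /andP[s0 f00].
move: usz; rewrite sE uniM size_mul // (polySpred s0) addSn /=.
exact: leq_trans (leq_addl _ _).
Qed.

(** The coefficient of X_3^2 is the value of the form at (0 : 0 : 1). *)
Lemma conic_size (f0 : {mpoly K[3]}) : f0 \is 2.-homog ->
  vanishes_at f0 (pt001 K) -> (size (uni f0) <= 2)%N.
Proof.
move=> f0_2 fz; have := restrict0E f0_2; rewrite (fz : f0.@[_] = 0) scale0r => r0.
have f02 : (uni f0)`_2 = 0.
  have [c cE] := dhomog0_const (uni_homog f0_2 (erefl : (2 + 0 = 2)%N)).
  have := congr1 (fun u : {poly K} => u`_2) r0.
  by rewrite /restrict coef_map coef0 /= cE mevalC => ->; rewrite mpolyC0.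
by apply/leq_sizeP => -[|[|[|i]]] // _; exact: uni_homog_gt f0_2 _.
Qed.

Lemma by_lines_lin3 d0 (f0 : {mpoly K[3]}) :
  plane_curve d0 f0 -> parameterizable_by_lines f0 ->
  only_singular_point f0 (pt001 K) ->
  exists j A B, [/\ A \is j.-homog, B \is j.+1.-homog, A != 0 & f0 = lin3 A B].
Proof.
move=> [f0_d f0_irr] f0_lines [f0z _].
have sz : (size (uni f0) <= 2)%N.
  case: f0z => [f0z|[f0_2 f0z]]; last exact: conic_size.
  exact: singular_size f0_d f0_irr f0_lines f0z.
have f0E : f0 = lin3 (uni f0)`_1 (uni f0)`_0.
  by rewrite -[LHS]uniK /lin3; congr emb3; apply: linear_polyE.
have [f0_nu f0_fact] := f0_irr.
have f00 := irreducible_mpoly_neq0 f0_irr.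
case: d0 => [/dhomog0_const[c cE]|j] in f0_d *.
  case/negP: f0_nu; apply/mpoly_unitP; exists c => //.
  by apply: contraNneq f00 => c0; rewrite cE c0 mpolyC0.
have A_j := uni_homog f0_d (add1n j); have B_j := uni_homog f0_d (add0n j.+1).
exists j, (uni f0)`_1, (uni f0)`_0; split=> //; apply/negP => /eqP A0.
(* With A = 0 the equation is an irreducible form in X_1, X_2, hence linear. A line is smooth and is
   not a conic, so both alternatives for p fail. *)
move: f0E; rewrite A0 /lin3 polyC0 mul0r add0r => f0E.
have [a [b [a0 b_j bE]]] := binary_form_split B_j.
have f0E' : f0 = emb3 (lform a)%:P * emb3 b%:P by rewrite {1}f0E bE polyCM emb3M.
have [/mpoly_unitP[c c0 lE]|/mpoly_unitP[c c0 bc]] := f0_fact _ _ f0E'.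
  have := congr1 (restrict a) lE; rewrite restrict_emb3C lform_root.
  rewrite /restrict uniC map_polyC /= mevalC => /esym/eqP.
  by rewrite !polyC_eq0 (negPf c0).
have bcE : b = c%:MP.
  by have := congr1 (@uni K) bc; rewrite uni_emb3C uniC => /polyC_inj.
have f0E2 : f0 = c *: (a 0 ord_max *: 'X_ord0 - a 0 ord0 *: 'X_mid3).
  rewrite f0E' bc mulrC mul_mpolyC emb3CE; congr (_ *: _).
  by rewrite /lform comp_mpolyB !comp_mpolyZ !comp_mpolyXt.
have b0 : b != 0 by rewrite bcE mpolyC_eq0.
have f0_1 : f0 \is 1.-homog.
  by rewrite f0E2 rpredZ // rpredB // rpredZ // dhomogXU.
case: f0z => [[_ dfz]|[f0_2 _]]; last by have := dhomog_uniq f00 f0_1 f0_2.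
case/negP: a0; apply/eqP/rowP => i; rewrite [RHS]mxE.
have dfE l : (mderiv l f0).@[pt001 K 0] =
    c * (a 0 ord_max * (ord0 == l)%:R - a 0 ord0 * (mid3 == l)%:R).
  rewrite f0E2 mderivZ mderivB !mderivZ !mderivXUE mevalZ mevalB !mevalZ.
  by congr (_ * (_ * _ - _ * _)); case: eqP; rewrite ?meval1 ?meval0.
have := dfz ord0; have := dfz mid3; rewrite /vanishes_at !dfE /=.
rewrite !mulr0 !mulr1 sub0r subr0 => /eqP + /eqP.
rewrite !mulf_eq0 (negPf c0) oppr_eq0 /= => /eqP a00 /eqP a01.
by case: (ord2P i) => ->.
Qed.

End Lines.

(** * The converse implication *)

Section Backward.

Variables (K : closedFieldType) (F1 F2 F3 : {mpoly K[3]}).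
Hypothesis F_quad : quadratic_transformation [tuple F1; F2; F3].
Variables (d : nat) (f : {mpoly K[3]}).
Hypotheses (f_d : f \is d.-homog) (f_irr : irreducible_mpoly f).

Let F := [tuple F1; F2; F3].
Let E := [tuple F1; F2].

Variables (j : nat) (A B : {mpoly K[2]}).
Hypotheses (A_j : A \is j.-homog) (B_j : B \is j.+1.-homog) (A0 : A != 0).
Hypothesis f0_irr : irreducible_mpoly (lin3 A B).
Hypothesis f0_image : forall p : 'rV[K]_3, p != 0 ->
  (zariski_closure (image_of_curve F f) p <-> vanishes_at (lin3 A B) p).

Let P := lin3_param A B.

(** The points P(t) lie on C_0, the closure of the image, so [g] vanishes at them. The factor [A]
    covers the parameters with P(t) = 0, where A(t) = 0 as well. *)
Lemma image_dense D (g : {mpoly K[3]}) : g \is D.-homog ->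
  (forall x : 'rV[K]_3, vanishes_at f x -> eval_forms F x != 0 ->
     vanishes_at g (eval_forms F x)) -> g \mPo P = 0.
Proof.
move=> g_D g_van; have P_j := lin3_param_homog A_j B_j.
have : A * (g \mPo P) = 0.
  apply: (binary_form_vanish (dhomogM A_j (dhomog_comp g_D P_j))) => t t0.
  rewrite mevalM -eval_comp.
  have [Pt|Pt] := eqVneq (eval_forms P t) 0.
    suff -> : A.@[t 0] = 0 by rewrite mul0r.
    have Pt0 : (A * 'X_ord0).@[t 0] = 0.
      by have := congr1 (fun r : 'rV_3 => r 0 ord0) Pt; rewrite !mxE.
    have Pt1 : (A * 'X_ord_max).@[t 0] = 0.
      by have := congr1 (fun r : 'rV_3 => r 0 mid3) Pt; rewrite !mxE.
    move: t0; rewrite row2_neq0 => /orP[] ti; apply: (mulIf ti).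
      by rewrite mul0r -Pt0 mevalM mevalXU.
    by rewrite mul0r -Pt1 mevalM mevalXU.
  have f0Pt : vanishes_at (lin3 A B) (eval_forms P t).
    by rewrite /vanishes_at eval_comp (lin3_comp_param A_j B_j) meval0.
  have Pt_cl := (f0_image Pt).2 f0Pt.
  rewrite (Pt_cl D g g_D _ : g.@[_] = 0) ?mulr0 // => y [x [x0 fx Fx yFx]].
  exact: vanishes_same_point g_D yFx (g_van x fx Fx).
by move=> /eqP; rewrite mulf_eq0 (negPf A0) => /eqP.
Qed.

Lemma kernel_lin3 D (g : {mpoly K[3]}) : g \is D.-homog -> g \mPo P = 0 ->
  exists q, g = q * lin3 A B.
Proof.
have X_1 : forms_of_degree 1 [tuple 'X_ord0; 'X_mid3 : {mpoly K[3]}].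
  by move=> i; case: (ord2P i) => ->; apply: dhomogXU.
exact: (curve_ideal X_1 (lin3_identity B A0) (lin3_homog A_j B_j) f0_irr
  (lin3_comp_param A_j B_j)).
Qed.

Lemma backward : parameterizable E f.
Proof.
have [F_2 F_cop [dG [G [G_d G_cop [h h0 hE] [h' h'0 h'E]]]]] := F_quad.
have P_j := lin3_param_homog A_j B_j.
have GF (x : 'rV[K]_3) i :
    (eval_forms G (eval_forms F x)) 0 i = h.@[x 0] * x 0 i.
  by rewrite mxE eval_comp -comp_formsE hE mevalM mevalXU.
(* If all G_i vanished on C_0, its equation would be a common factor of [G]. So the inverse is
   defined somewhere on C_0. *)
have [i0 Gi0] : exists i, tnth G i \mPo P != 0.
  apply: NNPP => no_i; have [f0_nu _] := f0_irr.
  case/negP: f0_nu; apply: G_cop => i; apply: kernel_lin3 (G_d i) _.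
  by apply/eqP/contraT => Gi; case: no_i; exists i.
have fGP : (f \mPo G) \mPo P = 0.
  apply: (image_dense (dhomog_comp f_d G_d)) => x fx Fx.
  rewrite /vanishes_at -eval_comp.
  by rewrite (@meval_scaled _ _ d h.@[x 0] f (x 0)) ?fx ?mulr0 // => i; exact: GF.
(* Otherwise F(G) = h' X vanishes on C_0. At y = F(x), with x on C, F(G(y)) = F(h(x) x) = h(x)^2
   F(x), so h(x) = 0 and G(y) = h(x) x = 0. By density G would vanish on C_0, against the choice of
   [i0]. *)
have h'P : h' \mPo P != 0.
  apply/negP => /eqP h'P0; case/negP: Gi0; apply/eqP.
  apply: (image_dense (G_d i0)) => x fx Fx.
  have f0Fx : (lin3 A B).@[eval_forms F x 0] = 0.
    apply/(f0_image Fx) => D g _ g_van; apply: g_van; exists x; split=> //.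
    + apply: contraNneq Fx => x0; apply/eqP/rowP => i; rewrite !mxE x0.
      by apply: (dhomog_meval0 (F_2 i)) => // l; rewrite mxE.
    + by exists 1; rewrite ?oner_neq0 ?scale1r.
  have hx : h.@[x 0] ^+ 2 *: eval_forms F x = 0.
    apply/rowP => i; rewrite !mxE.
    rewrite -(@meval_scaled _ _ 2 h.@[x 0] _ (x 0) _ (F_2 i) (GF x)) eval_comp.
    have [q ->] : exists q, tnth F i \mPo G = q * lin3 A B.
      apply: kernel_lin3 (dhomog_comp (F_2 i) G_d) _.
      by rewrite -comp_formsE h'E comp_mpolyM h'P0 mul0r.
    by rewrite mevalM f0Fx mulr0.
  move: hx => /eqP; rewrite scaler_eq0 (negPf Fx) orbF expf_eq0 /= => /eqP hx.
  by have := GF x i0; rewrite hx mul0r mxE.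
pose Q := comp_forms G P.
have QE i : tnth Q i = tnth G i \mPo P by rewrite comp_formsE.
have Q_e : forms_of_degree (j.+1 * dG) Q.
  by move=> i; rewrite QE; apply: dhomog_comp (G_d i) P_j.
have Qi0 : tnth Q i0 != 0 by rewrite QE.
have [e [m [phi [phi_e phi_cop m0 phiE]]]] := strip_common_factor Q_e Qi0.
have FQ i : tnth F i \mPo Q = (h' \mPo P) * tnth P i.
  by rewrite -comp_mpolyA -comp_formsE h'E comp_mpolyM comp_mpolyXt.
have Fphi i : m ^+ 2 * (tnth F i \mPo phi) = (h' \mPo P) * tnth P i.
  by rewrite -FQ (comp_scaled (F_2 i) phiE).
have E_2 : forms_of_degree 2 E.
  by move=> i; case: (ord2P i) => ->; [apply: (F_2 ord0)|apply: (F_2 mid3)].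
have fphi : f \mPo phi = 0.
  move/eqP: fGP; rewrite comp_mpolyA (comp_scaled f_d phiE) mulf_eq0.
  by rewrite expf_eq0 (negPf m0) andbF => /eqP.
apply: (parameterizableI f_d f_irr phi_e E_2 fphi _ phi_cop).
(* The square of [m] appears because the F_i have degree 2: m^2 F_i(phi) = h'(P) A X_i for the first
   two indices. *)
apply: (@identity_map_cancel K (e * 2) _ (m ^+ 2) ((h' \mPo P) * A)).
- by move=> i; rewrite comp_formsE; apply: dhomog_comp (E_2 i) phi_e.
- by rewrite expf_eq0.
- by rewrite mulf_neq0.
- move=> i; rewrite comp_formsE -mulrA.
  by case: (ord2P i) => ->; [apply: (Fphi ord0)|apply: (Fphi mid3)].
Qed.

End Backward.

Theorem theorem3p8 (K : closedFieldType)
    (L : closedFieldType) (iota : {rmorphism {fraction {mpoly K[2]}} -> L})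
    (L_closure : algebraic_closure iota)
    (F1 F2 : {mpoly K[3]})
    (F1_deg : F1 \is 2.-homog) (F2_deg : F2 \is 2.-homog)
    (F12_coprime : no_common_factor [tuple F1; F2])
    (F1_001 : vanishes_at F1 (pt001 K)) (F2_001 : vanishes_at F2 (pt001 K))
    (pencil_nondeg : ~ degenerate_conic (pencil iota F1 F2))
    (F3 : {mpoly K[3]}) (F3_deg : F3 \is 2.-homog)
    (F_quad : quadratic_transformation [tuple F1; F2; F3])
    (d : nat) (f : {mpoly K[3]}) (C_curve : plane_curve d f) (d_ge3 : (3 <= d)%N) :
  parameterizable [tuple F1; F2] f <->
  exists (d0 : nat) (f0 : {mpoly K[3]}),
    [/\ plane_curve d0 f0,
        parameterizable_by_lines f0,
        only_singular_point f0 (pt001 K) &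
        forall p : 'rV[K]_3, p != 0 ->
          (zariski_closure (image_of_curve [tuple F1; F2; F3] f) p <->
           vanishes_at f0 p)].
Proof.
have [f_d f_irr] := C_curve.
split; first exact (forward F_quad f_d f_irr d_ge3).
move=> [d0 [f0 [f0_curve f0_lines f0_sing f0_image]]].
have [j [A [B [A_j B_j A0 f0E]]]] := by_lines_lin3 f0_curve f0_lines f0_sing.
move: f0_curve f0_image; rewrite f0E => -[_ f0_irr] f0_image.
exact (backward F_quad f_d f_irr A_j B_j A0 f0_irr f0_image).
Qed.
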